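(* Let $\alpha,\beta\in\mathbb{C}\setminus\{-1,-2,\ldots\}$ with $\Re\alpha+\Re\beta>-1$. Let $1\le p\le+\infty$ and let $q$ be the exponent conjugate to $p$ (so $\frac1p+\frac1q=1$). Then $$\sup_{\|\varphi\|_p\le 1}\|DP_{\alpha,\beta}[\varphi](0)\| = \frac{|c_{\alpha,\beta}|}{2\pi}\left(\int_{-\pi}^{\pi}\Big||\alpha+1|+|\beta+1|e^{2it}\Big|^q\,dt\right)^{1/q},$$ where the supremum is over all $\varphi\in L^p(\mathbb{T})$ with $\|\varphi\|_p\le 1$, with the obvious modification in the case $p=1$, $q=+\infty$ (the factor $(\int_{-\pi}^{\pi}|\cdots|^q\,dt)^{1/q}$ is replaced by the supremum of $\big||\alpha+1|+|\beta+1|e^{2it}\big|$ over $t\in[-\pi,\pi]$).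
   Context: $\mathbb{D}$ is the open unit disc in $\mathbb{C}$, $\mathbb{T}=\partial\mathbb{D}$, and $m$ is the arc-length measure on $\mathbb{T}$ normalized so that $m(\mathbb{T})=1$; $L^p(\mathbb{T})$ and $\|\cdot\|_p$ are taken with respect to $m$ (complex-valued functions). For $\alpha,\beta\in\mathbb{C}$ put $$u_{\alpha,\beta}(z)=\frac{(1-|z|^2)^{\alpha+\beta+1}}{(1-z)^{\alpha+1}(1-\overline z)^{\beta+1}},\qquad |z|<1,$$ with principal branches of the powers. For $\alpha,\beta\in\mathbb{C}\setminus\{-1,-2,\dots\}$ with $\Re\alpha+\Re\beta>-1$ put $$c_{\alpha,\beta}=\frac{\Gamma(\alpha+1)\Gamma(\beta+1)}{\Gamma(\alpha+\beta+1)},$$ and for $f\in L^1(\mathbb{T})$ define the $(\alpha,\beta)$-Poisson integral $$P_{\alpha,\beta}[f](z)=\int_{\mathbb{T}}c_{\alpha,\beta}\,u_{\alpha,\beta}(z\overline\zeta)f(\zeta)\,dm(\zeta),\qquad z\in\mathbb{D}.$$ For a complex-valued $C^1$ function $f$ on a domain in $\mathbb{C}$, $Df(z)$ is its (real-linear) derivative at $z$ and $\|Df(z)\|=\sup\{|Df(z)\zeta|:|\zeta|=1\}=|f_z(z)|+|f_{\overline z}(z)|$, where $f_z=\frac12(f_x-if_y)$ and $f_{\overline z}=\frac12(f_x+if_y)$.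
   Formalization: For p<∞ the formula fails with the norm taken in normalized m (α=β=0, p=2). Proved instead: with m, the value |c|·((1/2π)∫|…|^q dt)^{1/q} (|c|·sup if p=1); and the displayed formula with ‖φ‖_p taken in un-normalized arc length. *)

(* Defs.v *)
From HB Require Import structures.
From mathcomp Require Export all_boot all_order all_algebra.
From mathcomp Require Export all_classical all_reals all_analysis.
From mathcomp.real_closed Require Export complex.
From mathcomp Require Import interval_inference.

Set Implicit Arguments.
Unset Strict Implicit.
Unset Printing Implicit Defensive.

Import Order.TTheory GRing.Theory Num.Theory.
Import numFieldNormedType.Exports.

Local Open Scope classical_set_scope.
Local Open Scope complex_scope.
Local Open Scope ring_scope.

Section Defs.
Context {R : realType}.
Implicit Types (z w a : R[i]) (f : R[i] -> R[i]).

Definition cmod z : R := ComplexField.Normc.normc z.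

(** Principal branch, with values in ]-pi, pi] for [z != 0]. *)
Definition cArg z : R :=
  let t := acos (complex.Re z / cmod z) in
  if 0 <= complex.Im z then t else - t.

Definition cexp z : R[i] :=
  (expR (complex.Re z) * cos (complex.Im z)) +i*
  (expR (complex.Re z) * sin (complex.Im z)).

Definition cLog z : R[i] := ln (cmod z) +i* cArg z.

(** Only meaningful for [w != 0]. *)
Definition cpow w a : R[i] := cexp (a * cLog w).

Definition Cintegral (mu : {measure set (measurableTypeR R) -> \bar R})
    (D : set R) (g : R -> R[i]) : R[i] :=
  (\int[mu]_(t in D) complex.Re (g t))%R +i*
  (\int[mu]_(t in D) complex.Im (g t))%R.

(** Euler's integral, for [0 < Re z]. *)
Definition EulerGamma z : R[i] :=
  Cintegral lebesgue_measure `]0, +oo[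
    (fun t : R => cpow t%:C (z - 1) * (expR (- t))%:C).

(** Extension to all z outside {0, -1, -2, ...} by
    Gamma(z) = Gamma(z + n) / (z (z + 1) ... (z + n - 1)),
    where n is the least natural number such that 0 < Re z + n. *)
Definition cGamma z : R[i] :=
  let n := Num.truncn (1 - complex.Re z) in
  EulerGamma (z + n%:R) / \prod_(k < n) (z + k%:R).

Definition eit (t : R) : R[i] := cos t +i* sin t.

(** Measures on the unit circle are carried by the parameter [t] of
    [eit t], with [t] in [-pi, pi]: [arc_measure] is arc length (total mass [2 * pi])
    and [circle_measure] is its normalization (total mass [1]). *)
Definition arc_measure : {measure set (measurableTypeR R) -> \bar R} :=
  mrestr lebesgue_measure (measurable_itv `[- (pi : R), pi]).

Lemma inv2pi_ge0 : 0 <= (2 * (pi : R))^-1.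
Proof. by rewrite invr_ge0 mulr_ge0// pi_ge0. Qed.

Definition circle_measure : {measure set (measurableTypeR R) -> \bar R} :=
  mscale (NngNum inv2pi_ge0) arc_measure.

Definition u (alpha beta : R[i]) z : R[i] :=
  cpow (1 - `|z| ^+ 2) (alpha + beta + 1) /
  (cpow (1 - z) (alpha + 1) * cpow (1 - conjc z) (beta + 1)).

Definition cab (alpha beta : R[i]) : R[i] :=
  cGamma (alpha + 1) * cGamma (beta + 1) / cGamma (alpha + beta + 1).

Definition Poisson (alpha beta : R[i]) f z : R[i] :=
  Cintegral circle_measure setT (fun t =>
    cab alpha beta * u alpha beta (z * conjc (eit t)) * f (eit t)).

(** The unit ball of L^p of the circle, for the normalization of arc length
    given by [mu]; a function on the circle is represented by a function on
    [R[i]] of which only the values at the points [eit t] are used. *)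
Definition Lp_ball (mu : {measure set (measurableTypeR R) -> \bar R})
    (p : \bar R) : set (R[i] -> R[i]) :=
  [set f | [/\ measurable_fun setT (fun t : measurableTypeR R => complex.Re (f (eit t))),
               measurable_fun setT (fun t : measurableTypeR R => complex.Im (f (eit t)))
             & (Lnorm mu p (fun t => (cmod (f (eit t)))%:E) <= 1)%E]].

(** [R[i]] is not a normed module over [R] in the library, so the real-linear
    derivative is taken through the identification with [R * R]. *)
Definition toR2 z : R * R := (complex.Re z, complex.Im z).
Definition ofR2 (x : R * R) : R[i] := x.1 +i* x.2.

Definition Dreal f z w : R[i] :=
  ofR2 ('d (fun x : R * R => toR2 (f (ofR2 x))) (toR2 z) (toR2 w)).

Definition Dnorm f z : R := sup [set cmod (Dreal f z w) | w in [set w | cmod w = 1]].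

(** (s * \int_(-pi)^pi F(t)^q dt)^(1/q), and the supremum of F over [-pi, pi]
    when q = +oo. *)
Definition qmean (s : R) (q : \bar R) (F : R -> R) : R :=
  match q with
  | r%:E => (s * (\int[lebesgue_measure]_(t in `[- (pi : R), pi]) (F t `^ r))%R)
              `^ r^-1
  | _ => sup [set F t | t in `[- (pi : R), pi]]
  end.

End Defs.

(* Main.v *)
(** Near the origin u(z) = 1 + (alpha+1) z + (beta+1) conj(z) + o(|z|), uniformly
    along the circle, so that DP[phi](0) w is c_{alpha,beta} times the integral of
    phi against K_w(zeta) = (alpha+1) w conj(zeta) + (beta+1) conj(w) zeta.  For
    |w| = 1 the modulus of K_w is a rotation of ||alpha+1| + |beta+1| zeta^2|, hence
    its L^q norm does not depend on w; Hoelder's inequality gives the upper bound.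
    For the lower bound, w is chosen so that no rotation is left, and phi is the
    usual extremal function conj(K_w) |K_w|^(q-2), or, when p = 1, the phase
    conj(K_w) / |K_w| concentrated on a set where |K_w| is nearly maximal.  Both
    normalizations of arc length are instances of k times arc length, k > 0. *)

From HB Require Import structures.
Require Import Defs.
From mathcomp Require Import measurable_realfun hoelder ess_sup_inf ring lra.
From mathcomp Require Import interval_inference.

Set Implicit Arguments.
Unset Strict Implicit.
Unset Printing Implicit Defensive.

Import Order.TTheory GRing.Theory Num.Theory.
Import numFieldNormedType.Exports.
Local Open Scope classical_set_scope.
Local Open Scope complex_scope.
Local Open Scope ring_scope.

(** * Complex-valued integrals *)

Section complex_modulus.
Context {R : realType}.
Implicit Types (z w : R[i]) (s t : R).

(** Principal powers are awkward to differentiate, since [cArg] is an arccosine whose sign is chosen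
    by cases. But 1 - z stays in the right half-plane for |z| < 1, where the argument is an
    arctangent; so [u] is the exponential of an explicit smooth expression vanishing at the origin,
    and the same formula gives measurability along circles. Uniformity along the circle costs
    nothing: |z conj(zeta)| = |z|, so an expansion at the single point 0 suffices, and an integrable
    phi is enough to differentiate under the integral. The Poisson integral always uses the
    normalized measure, whereas the unit ball belongs to k times arc length. Hence the common value
    |c| / (2 pi k) (k \int F^q)^(1/q), where F is the modulus in the statement: the factor 1 / (2
    pi) stands outside the root for k = 1 and inside it for k = 1 / (2 pi). For q = +oo the last
    factor is sup F. *)

Lemma cmodE z : cmod z = Num.sqrt (complex.Re z ^+ 2 + complex.Im z ^+ 2).
Proof. by case: z. Qed.

Lemma normr_cmod z : `|z| = (cmod z)%:C.
Proof. by rewrite normc_def cmodE. Qed.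

Lemma cmod_ge0 z : 0 <= cmod z.
Proof. by rewrite cmodE sqrtr_ge0. Qed.

Lemma cmodM z w : cmod (z * w) = cmod z * cmod w.
Proof. exact: ComplexField.Normc.normcM. Qed.

Lemma cmodD z w : cmod (z + w) <= cmod z + cmod w.
Proof. exact: le_normcD. Qed.

Lemma cmod0 : cmod 0 = 0 :> R.
Proof. exact: ComplexField.Normc.normc0. Qed.

Lemma cmod1 : cmod 1 = 1 :> R.
Proof. exact: ComplexField.Normc.normc1. Qed.

Lemma cmod_eq0 z : cmod z = 0 -> z = 0.
Proof. exact: ComplexField.Normc.eq0_normc. Qed.

Lemma cmod_gt0 z : z != 0 -> 0 < cmod z.
Proof. by move=> z0; rewrite lt0r cmod_ge0 andbT; apply: contra z0 => /eqP/cmod_eq0/eqP. Qed.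

Lemma sqr_cmod z : cmod z ^+ 2 = complex.Re z ^+ 2 + complex.Im z ^+ 2.
Proof. by rewrite cmodE sqr_sqrtr// addr_ge0 ?sqr_ge0. Qed.

Lemma cmod_conjc z : cmod (conjc z) = cmod z.
Proof. by rewrite !cmodE; case: z => a b /=; rewrite sqrrN. Qed.

Lemma cmod_real t : cmod t%:C = `|t|.
Proof. by rewrite cmodE /= expr0n addr0 sqrtr_sqr. Qed.

Lemma mulc_conj z : z * conjc z = (cmod z ^+ 2)%:C.
Proof. by rewrite -sqr_normc normr_cmod rmorphXn. Qed.

Lemma Re_le_cmod z : `|complex.Re z| <= cmod z.
Proof. by rewrite cmodE -sqrtr_sqr ler_wsqrtr// lerDl sqr_ge0. Qed.

Lemma Im_le_cmod z : `|complex.Im z| <= cmod z.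
Proof. by rewrite cmodE -sqrtr_sqr ler_wsqrtr// lerDr sqr_ge0. Qed.

Lemma cmod_le_ReIm z : cmod z <= `|complex.Re z| + `|complex.Im z|.
Proof.
rewrite -(@ler_pXn2r _ 2) ?nnegrE ?cmod_ge0 ?addr_ge0//.
rewrite sqr_cmod sqrrD !real_normK ?num_real// -addrA (addrC (_ *+ 2)) addrA lerDl.
by rewrite mulrn_wge0// mulr_ge0.
Qed.

Lemma cmod_eit t : cmod (eit t) = 1.
Proof. by rewrite cmodE /= cos2Dsin2 sqrtr1. Qed.

Lemma eitD s t : eit (s + t) = eit s * eit t :> R[i].
Proof. by rewrite /eit cosD sinD; simpc; congr (_ +i* _); rewrite addrC. Qed.

Lemma conjc_eit t : conjc (eit t) = eit (- t) :> R[i].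
Proof. by rewrite /eit cosN sinN. Qed.

Lemma eit0 : eit 0 = 1 :> R[i].
Proof. by rewrite /eit cos0 sin0. Qed.

Lemma eitD2pi t : eit (t + 2 * pi) = eit t :> R[i].
Proof. by rewrite /eit mulr_natl cosD2pi sinD2pi. Qed.

(** Covers z = 0 too, where the quotient is 0 by convention. These bounds later keep a rotation
    angle within one period. *)
Lemma cArg_bound z : - pi <= cArg z <= pi.
Proof.
have h : -1 <= complex.Re z / cmod z <= 1.
  rewrite -ler_norml normrM normfV (ger0_norm (cmod_ge0 z)).
  have [->|z0] := eqVneq z 0; first by rewrite cmod0 invr0 mulr0 ler01.
  by rewrite ler_pdivrMr ?cmod_gt0// mul1r Re_le_cmod.
rewrite /cArg; case: ifP => _.
  by rewrite acos_lepi// andbT (le_trans _ (acos_ge0 h))// oppr_le0 pi_ge0.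
by rewrite lerN2 acos_lepi//= (le_trans _ (pi_ge0 R))// oppr_le0 acos_ge0.
Qed.

Lemma polar z : z = (cmod z)%:C * eit (cArg z).
Proof.
have [->|z0] := eqVneq z 0; first by rewrite cmod0 mul0r.
have c0 := cmod_gt0 z0.
have h : -1 <= complex.Re z / cmod z <= 1.
  rewrite -ler_norml normrM normfV (ger0_norm (cmod_ge0 z)).
  by rewrite ler_pdivrMr// mul1r Re_le_cmod.
have hr : cmod z * (complex.Re z / cmod z) = complex.Re z.
  by rewrite mulrC divfK// gt_eqF.
have hs : cmod z * Num.sqrt (1 - (complex.Re z / cmod z) ^+ 2) = `|complex.Im z|.
  have -> : 1 - (complex.Re z / cmod z) ^+ 2 = (complex.Im z / cmod z) ^+ 2.
    rewrite !expr_div_n -[1](@divff _ (cmod z ^+ 2)) ?expf_neq0 ?gt_eqF//.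
    by rewrite -mulrBl sqr_cmod addrC addKr.
  by rewrite sqrtr_sqr normrM normfV (ger0_norm (cmod_ge0 z)) mulrC divfK// gt_eqF.
apply/eqP; rewrite eq_complex /eit /cArg; case: ifPn => /= z1.
  rewrite acosK ?in_itv//= sin_acos// !mul0r subr0 addr0 hr hs ger0_norm// !eqxx//.
rewrite cosN sinN acosK ?in_itv//= sin_acos// !mul0r subr0 addr0 mulrN hr hs.
by rewrite ltr0_norm ?ltNge// opprK !eqxx.
Qed.

End complex_modulus.

(** * Measurability and integration through real and imaginary parts *)

Section complex_integral.
Context {R : realType}.
Implicit Types (mu : {measure set (measurableTypeR R) -> \bar R}).
Local Notation T := (measurableTypeR R).
Implicit Types (f g : T -> R[i]) (a z : R[i]).

Definition cmeasurable f :=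
  measurable_fun [set: T] (fun t : T => complex.Re (f t)) /\
  measurable_fun [set: T] (fun t : T => complex.Im (f t)).

Definition cintegrable mu f :=
  mu.-integrable [set: T] (fun t : T => (complex.Re (f t))%:E) /\
  mu.-integrable [set: T] (fun t : T => (complex.Im (f t))%:E).

Lemma cmeasurable_cst a : cmeasurable (fun=> a).
Proof. by split; exact: measurable_cst. Qed.

Lemma cmeasurable_real (h : T -> R) : measurable_fun setT h -> cmeasurable (fun t => (h t)%:C).
Proof. by move=> mh; split => //=; exact: measurable_cst. Qed.

Lemma Re_conjc z : complex.Re (conjc z) = complex.Re z.
Proof. by case: z. Qed.

Lemma Im_conjc z : complex.Im (conjc z) = - complex.Im z.
Proof. by case: z. Qed.

Lemma cmeasurable_conjc f : cmeasurable f -> cmeasurable (fun t => conjc (f t)).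
Proof.
move=> [mr mi]; split; first by under eq_fun do rewrite Re_conjc.
by under eq_fun do rewrite Im_conjc; exact: measurableT_comp.
Qed.

Lemma cmeasurableD f g : cmeasurable f -> cmeasurable g -> cmeasurable (fun t => f t + g t).
Proof.
move=> [mfr mfi] [mgr mgi]; split.
  under eq_fun do rewrite raddfD /=; exact: measurable_funD.
under eq_fun do rewrite raddfD /=; exact: measurable_funD.
Qed.

Lemma ReM z w : complex.Re (z * w) =
  complex.Re z * complex.Re w - complex.Im z * complex.Im w :> R.
Proof. by case: z; case: w. Qed.

Lemma ImM z w : complex.Im (z * w) =
  complex.Re z * complex.Im w + complex.Im z * complex.Re w :> R.
Proof. by case: z => a b; case: w. Qed.

Lemma cmeasurableM f g : cmeasurable f -> cmeasurable g -> cmeasurable (fun t => f t * g t).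
Proof.
move=> [mfr mfi] [mgr mgi]; split.
  by under eq_fun do rewrite ReM; apply: measurable_funB; apply: measurable_funM.
by under eq_fun do rewrite ImM; apply: measurable_funD; apply: measurable_funM.
Qed.

Lemma measurable_cmod f : cmeasurable f -> measurable_fun setT (fun t => cmod (f t)).
Proof.
move=> [mr mi]; under eq_fun do rewrite cmodE.
apply: (@measurableT_comp _ _ _ _ _ _ (@Num.sqrt R)).
  exact: continuous_measurable_fun (@sqrt_continuous R).
by apply: measurable_funD; exact: measurable_funX.
Qed.

Lemma cmeasurable_eit : cmeasurable (@eit R).
Proof.
by split; apply: continuous_measurable_fun; [exact: continuous_cos | exact: continuous_sin].
Qed.

Lemma cintegrable_measurable mu f : cintegrable mu f -> cmeasurable f.
Proof. by move=> [/measurable_int/measurable_EFinP ? /measurable_int/measurable_EFinP ?]. Qed.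

(** Integrability of the two parts suits linearity, integrability of the modulus suits domination;
    |z| <= |Re z| + |Im z| and |Re z|, |Im z| <= |z| pass between them. *)
Lemma cintegrableP mu f : cintegrable mu f <->
  cmeasurable f /\ mu.-integrable setT (fun t => (cmod (f t))%:E).
Proof.
split=> [fi|[[mr mi] fi]].
  have mf := cintegrable_measurable fi; split => //.
  have [ir ii] := fi.
  apply: (@le_integrable _ _ _ mu setT _ _
    (fun t => `|(complex.Re (f t))%:E| + `|(complex.Im (f t))%:E|)%E) => //.
  - by apply/measurable_EFinP; exact: measurable_cmod.
  - move=> t _ /=; rewrite lee_fin ger0_norm ?cmod_ge0// ger0_norm ?addr_ge0//.
    exact: cmod_le_ReIm.
  - by apply: integrableD => //; exact: integrable_abse.
split; apply: (@le_integrable _ _ _ mu setT _ _ (fun t => (cmod (f t))%:E)) => //.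
- exact/measurable_EFinP.
- by move=> t _ /=; rewrite lee_fin (ger0_norm (cmod_ge0 _)) Re_le_cmod.
- exact/measurable_EFinP.
- by move=> t _ /=; rewrite lee_fin (ger0_norm (cmod_ge0 _)) Im_le_cmod.
Qed.

Lemma cintegrableMl mu f g (M : R) : cmeasurable g -> (forall t, cmod (g t) <= M) ->
  cintegrable mu f -> cintegrable mu (fun t => g t * f t).
Proof.
move=> mg gM /cintegrableP[mf fi]; apply/cintegrableP; split.
  exact: cmeasurableM.
apply: (@le_integrable _ _ _ mu setT _ _ (fun t => M%:E * (cmod (f t))%:E)%E) => //.
- by apply/measurable_EFinP; apply: measurable_cmod; exact: cmeasurableM.
- move=> t _ /=; rewrite lee_fin ger0_norm ?cmod_ge0// cmodM.
  rewrite (le_trans _ (ler_norm _))// ler_wpM2r ?cmod_ge0//.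
- exact: integrableZl.
Qed.

Lemma cintegrableD mu f g : cintegrable mu f -> cintegrable mu g ->
  cintegrable mu (fun t => f t + g t).
Proof.
move=> [fr fi] [gr gi]; split.
  by under eq_fun do rewrite raddfD /= EFinD; apply: integrableD.
by under eq_fun do rewrite raddfD /= EFinD; apply: integrableD.
Qed.

Lemma CintegralD mu f g : cintegrable mu f -> cintegrable mu g ->
  Cintegral mu setT (fun t => f t + g t) = Cintegral mu setT f + Cintegral mu setT g.
Proof.
move=> [fr fi] [gr gi]; rewrite /Cintegral; simpc; congr (_ +i* _).
  by rewrite -RintegralD//; apply: eq_Rintegral => t _; rewrite raddfD.
by rewrite -RintegralD//; apply: eq_Rintegral => t _; rewrite raddfD.
Qed.

Lemma cintegrableZl mu a f : cintegrable mu f -> cintegrable mu (fun t => a * f t).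
Proof. by apply: (@cintegrableMl _ _ _ (cmod a)) => //; exact: cmeasurable_cst. Qed.

Lemma CintegralZl mu a f : cintegrable mu f ->
  Cintegral mu setT (fun t => a * f t) = a * Cintegral mu setT f.
Proof.
move=> [fr fi]; rewrite /Cintegral; apply/eqP; rewrite eq_complex; apply/andP; split; apply/eqP.
  rewrite ReM /= -!RintegralZl// -RintegralB//.
  - by apply: eq_Rintegral => t _; rewrite ReM.
  - exact: (integrableZl measurableT (complex.Re a) fr).
  - exact: (integrableZl measurableT (complex.Im a) fi).
rewrite ImM /= -!RintegralZl// -RintegralD//.
- by apply: eq_Rintegral => t _; rewrite ImM.
- exact: (integrableZl measurableT (complex.Re a) fi).
- exact: (integrableZl measurableT (complex.Im a) fr).
Qed.

Lemma eq_Cintegral mu f g : f =1 g -> Cintegral mu setT f = Cintegral mu setT g.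
Proof. by move=> fg; congr (Cintegral mu setT _); apply/funext. Qed.

(* Rotating the integral onto the positive half-line reduces the claim to real parts. *)
Lemma le_cmod_Cintegral mu f : cintegrable mu f ->
  cmod (Cintegral mu setT f) <= \int[mu]_t cmod (f t).
Proof.
move=> fi; set I := Cintegral _ _ _.
have [mf ci] := (cintegrableP _ _).1 fi.
set e := eit (- cArg I).
have eI : e * I = (cmod I)%:C.
  by rewrite {1}(polar I) mulrCA -eitD addNr eit0 mulr1.
have -> : cmod I = complex.Re (Cintegral mu setT (fun t => e * f t)).
  by rewrite CintegralZl// -/I eI.
apply: le_Rintegral => //; first by have [] := cintegrableZl e fi.
move=> t _; rewrite (le_trans (ler_norm _))// (le_trans (Re_le_cmod _))//.
by rewrite cmodM cmod_eit mul1r.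
Qed.

End complex_integral.

(** * First-order expansion of [u] at the origin *)

Section differentials.
Context {R : realType}.
Local Notation V := (R * R)%type.
Implicit Types (f g df dg : V -> R) (x : V).

Lemma is_diff_fst x : is_diff x (@fst R R) (@fst R R).
Proof.
have l : linear (@fst R R) by [].
pose lM := GRing.isLinear.Build _ _ _ _ _ l.
pose L : {linear V -> R} := HB.pack (@fst R R) lM.
have c : continuous L by move=> y; exact: cvg_fst.
by apply: DiffDef; [exact: (linear_differentiable (f := L))|exact: (diff_lin (f := L))].
Qed.

Lemma is_diff_snd x : is_diff x (@snd R R) (@snd R R).
Proof.
have l : linear (@snd R R) by [].
pose lM := GRing.isLinear.Build _ _ _ _ _ l.
pose L : {linear V -> R} := HB.pack (@snd R R) lM.
have c : continuous L by move=> y; exact: cvg_snd.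
by apply: DiffDef; [exact: (linear_differentiable (f := L))|exact: (diff_lin (f := L))].
Qed.

Lemma is_diff_comp1 f df (g : R -> R) (d : R) x :
  is_diff x f df -> is_derive (f x) 1 g d ->
  is_diff x (fun y => g (f y)) (fun h => d * df h).
Proof.
move=> Df [dg gd].
have Dg : is_diff (f x) g (fun h => h * d).
  by apply: DiffDef; [exact/derivable1_diffP|rewrite deriv1E// derive1E gd].
apply: (is_diff_eq (is_diff_comp Df Dg)).
by apply/funext => h /=; rewrite mulrC.
Qed.

Lemma is_diff_eqf f g df dg x : is_diff x f df -> f =1 g -> df =1 dg -> is_diff x g dg.
Proof. by move=> D /funext <- /funext <-. Qed.

(** In this explicit form [d] constrains only the size of [h], which is what yields uniformity over
    a whole circle of increments. *)
Lemma is_diff_littleo f df (x : V) (e : R) : is_diff x f df -> 0 < e ->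
  exists2 d, 0 < d & forall h : V, `|h| < d -> `|f (h + x) - f x - df h| <= e * `|h|.
Proof.
move=> D e0; have [Df dfE] := D.
have /eqaddoP /(_ e e0) := diff_locally Df.
rewrite dfE => /nbhs_ballP[d /= d0 H]; exists d => // h hd.
have /= := H h; rewrite -ball_normE /= sub0r normrN => /(_ hd).
by rewrite !fctE opprD addrA.
Qed.

End differentials.

(** * The kernel [u] as an exponential, and its expansion *)

Section kernel.
Context {R : realType}.
Implicit Types (z w a b : R[i]).

(** Since cos(atan y) = 1 / sqrt(1 + y^2) = Re w / |w|, the arccosine returns |atan y|, and the sign
    chosen by cases is that of y. Unlike the original formula, the arctangent is visibly smooth
    across the real axis. *)
Lemma cArg_atan w : 0 < complex.Re w -> cArg w = atan (complex.Im w / complex.Re w).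
Proof.
move=> w0; set y := complex.Im w / complex.Re w.
have -> : cArg w = if 0 <= y then acos (cos (atan y)) else - acos (cos (atan y)).
  have -> : (0 <= y) = (0 <= complex.Im w) by rewrite /y pmulr_lge0// invr_gt0.
  rewrite /cArg; suff -> : complex.Re w / cmod w = cos (atan y) by [].
  rewrite cos_atan; have -> : 1 + y ^+ 2 = (cmod w / complex.Re w) ^+ 2.
    by rewrite !expr_div_n sqr_cmod mulrDl divff// expf_neq0// gt_eqF.
  rewrite sqrtr_sqr ger0_norm ?invf_div//.
  by rewrite divr_ge0 ?cmod_ge0// ltW.
have lt2 := atan_ltpi2 y; have gt2 := atan_gtNpi2 y.
have pi0 := pi_gt0 R.
have [y0|y0] := leP 0 y.
  have := le_atan y0; rewrite atan0 => a0.
  by rewrite cosK// in_itv/= a0/=; lra.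
have := lt_atan y0; rewrite atan0 => a0.
by rewrite cosKN ?opprK//; apply/andP; split; lra.
Qed.

Lemma cLog_conjc w : 0 < complex.Re w -> cLog (conjc w) = conjc (cLog w).
Proof.
move=> w0; rewrite /cLog cmod_conjc cArg_atan ?Re_conjc// Im_conjc mulNr atanN.
by rewrite -cArg_atan.
Qed.

Lemma cLog_real (t : R) : 0 < t -> cLog t%:C = (ln t)%:C.
Proof. by move=> t0; rewrite /cLog cmod_real gtr0_norm// cArg_atan//= mul0r atan0. Qed.

Lemma cexpD z w : cexp (z + w) = cexp z * cexp w.
Proof.
case: z => a b; case: w => c d; rewrite /cexp /= expRD cosD sinD.
by simpc; congr (_ +i* _); ring.
Qed.

Lemma cexpN z : cexp (- z) = (cexp z)^-1.
Proof.
have e1 : cexp z * cexp (- z) = 1.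
  by rewrite -cexpD subrr /cexp /= expR0 cos0 sin0 !mul1r.
have z0 : cexp z != 0.
  by apply/eqP => h; move: e1; rewrite h mul0r => /esym/eqP; rewrite oner_eq0.
by apply: (mulfI z0); rewrite e1 divff.
Qed.

(* [ell0], [ell] and [theta] are ln(1 - |z|^2), ln|1 - z| and Arg(1 - z); for |z| < 1,
   [uexp_re] and [uexp_im] are the real and imaginary parts of a logarithm of [u]. *)
Definition ell0 (x : R * R) : R := ln (1 - (x.1 * x.1 + x.2 * x.2)).
Definition ell (x : R * R) : R :=
  ln (Num.sqrt ((1 - x.1) * (1 - x.1) + x.2 * x.2)).
Definition theta (x : R * R) : R := atan (- x.2 * (1 - x.1)^-1).

Definition uexp_re (alpha beta : R[i]) (x : R * R) : R :=
  complex.Re (alpha + beta + 1) * ell0 x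
  + (- complex.Re (alpha + 1) - complex.Re (beta + 1)) * ell x
  + (complex.Im (alpha + 1) - complex.Im (beta + 1)) * theta x.

Definition uexp_im (alpha beta : R[i]) (x : R * R) : R :=
  complex.Im (alpha + beta + 1) * ell0 x
  + (- complex.Im (alpha + 1) - complex.Im (beta + 1)) * ell x
  + (complex.Re (beta + 1) - complex.Re (alpha + 1)) * theta x.

Lemma cmod_lt1_Re z : cmod z < 1 -> 0 < 1 - complex.Re z.
Proof. by move=> z1; rewrite subr_gt0 (le_lt_trans (ler_norm _))// (le_lt_trans (Re_le_cmod _)). Qed.

(** With 1 - z in the right half-plane, the logarithm commutes with conjugation, so the three powers
    merge into one exponential. *)
Lemma uE (alpha beta z : R[i]) : cmod z < 1 ->
  u alpha beta z = cexp (uexp_re alpha beta (toR2 z) +i* uexp_im alpha beta (toR2 z)).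
Proof.
move=> z1; have r0 := cmod_lt1_Re z1.
have R1 : 0 < complex.Re (1 - z) by case: (z) r0.
rewrite /u normr_cmod -rmorphXn -(rmorphB (real_complex R) 1) /cpow.
have -> : 1 - conjc z = conjc (1 - z) by rewrite rmorphB rmorph1.
rewrite cLog_conjc// cLog_real; last first.
  by rewrite subr_gt0 expr_lt1// cmod_ge0.
rewrite -cexpD -cexpN -cexpD; congr cexp.
have l0 : ln (1 - cmod z ^+ 2) = ell0 (toR2 z) by rewrite sqr_cmod !expr2.
have l1 : cLog (1 - z) = ell (toR2 z) +i* theta (toR2 z).
  rewrite /cLog cArg_atan// cmodE; case: (z) => x y /=.
  by rewrite /ell /theta /= sub0r !expr2 mulrNN.
rewrite l0 l1 /uexp_re /uexp_im.
set A := alpha + 1; set B := beta + 1; set C := alpha + beta + 1.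
case: A => a1 a2; case: B => b1 b2; case: C => c1 c2.
by apply/eqP; rewrite eq_complex /=; apply/andP; split; apply/eqP; ring.
Qed.

(** The numerator of [u] depends on |z|^2 and has no linear term at the origin. *)
Lemma is_diff_ell0 : is_diff (0 : R * R) ell0 (fun=> 0).
Proof.
have D1 := is_diff_fst (0 : R * R); have D2 := is_diff_snd (0 : R * R).
have S := is_diffB (is_diff_cst (1 : R) 0) (is_diffD (is_diffM D1 D1) (is_diffM D2 D2)).
have H : is_derive (1 - (0 * 0 + 0 * 0) : R) 1 (@ln R) (1 - (0 * 0 + 0 * 0))^-1.
  by apply: is_derive1_ln; rewrite mul0r addr0 subr0.
apply: (is_diff_eqf (is_diff_comp1 S H)) => // h.
by rewrite !fctE /= !scale0r !addr0 subr0 mulr0.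
Qed.

Lemma is_diff_1B : is_diff (0 : R * R) (fun x => 1 - x.1) (fun h => - h.1).
Proof.
apply: (is_diff_eqf (is_diffB (is_diff_cst (1 : R) 0) (is_diff_fst (0 : R * R)))) => // h.
by rewrite !fctE sub0r.
Qed.

Lemma is_diff_ell : is_diff (0 : R * R) ell (fun h => - h.1).
Proof.
have D1 := is_diff_1B; have D2 := is_diff_snd (0 : R * R).
have S := is_diffD (is_diffM D1 D1) (is_diffM D2 D2).
have H : is_derive ((1 - 0) * (1 - 0) + 0 * 0 : R) 1 (@Num.sqrt R)
    (2 * Num.sqrt ((1 - 0) * (1 - 0) + 0 * 0))^-1.
  by apply: is_derive1_sqrt; rewrite subr0 mul0r addr0 mul1r.
have {H}S := is_diff_comp1 S H.
have H : is_derive (Num.sqrt ((1 - 0) * (1 - 0) + 0 * 0) : R) 1 (@ln R)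
    (Num.sqrt ((1 - 0) * (1 - 0) + 0 * 0))^-1.
  by apply: is_derive1_ln; rewrite subr0 mul0r addr0 mul1r sqrtr1.
apply: (is_diff_eqf (is_diff_comp1 S H)) => // h.
rewrite !fctE /= !scale0r !addr0 !subr0 mul0r addr0 mul1r sqrtr1 scale1r.
by rewrite invr1 mul1r; field.
Qed.

Lemma is_diff_theta : is_diff (0 : R * R) theta (fun h => - h.2).
Proof.
have D1 := is_diff_1B; have D2 := is_diffN (is_diff_snd (0 : R * R)).
have H : is_derive (1 - 0 : R) 1 (fun x : R => x^-1) (- (1 - 0) ^- 2 *: 1).
  by apply: is_deriveV => //; rewrite subr0 oner_neq0.
have S := is_diffM D2 (is_diff_comp1 D1 H).
have {}H := is_derive1_atan (- 0 * (1 - 0)^-1 : R).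
apply: (is_diff_eqf (is_diff_comp1 S H)) => // h.
rewrite !fctE /= !subr0 oppr0 mul0r expr0n addr0 !invr1 mul1r.
by rewrite scale0r add0r scale1r.
Qed.

Lemma is_diff_lin3 (f1 f2 f3 d1 d2 d3 : R * R -> R) (c1 c2 c3 : R) x :
  is_diff x f1 d1 -> is_diff x f2 d2 -> is_diff x f3 d3 ->
  is_diff x (fun y => c1 * f1 y + c2 * f2 y + c3 * f3 y)
            (fun h => c1 * d1 h + c2 * d2 h + c3 * d3 h).
Proof.
move=> D1 D2 D3.
exact: (is_diff_eqf (is_diffD (is_diffD (is_diffZ c1 D1) (is_diffZ c2 D2)) (is_diffZ c3 D3))).
Qed.

Lemma uexp_at0 alpha beta : uexp_re alpha beta 0 = 0 /\ uexp_im alpha beta 0 = 0.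
Proof.
have l0 : ell0 0 = 0 by rewrite /ell0 /= mul0r addr0 subr0 ln1.
have l1 : ell 0 = 0 by rewrite /ell /= subr0 mulr1 mul0r addr0 sqrtr1 ln1.
have t0 : theta 0 = 0 by rewrite /theta /= oppr0 mul0r atan0.
by rewrite /uexp_re /uexp_im l0 l1 t0 !mulr0 !addr0.
Qed.

(* The differential of [u alpha beta] at the origin. *)
Definition ulin (alpha beta z : R[i]) : R[i] :=
  (alpha + 1) * z + (beta + 1) * conjc z.

(** The logarithm vanishes at the origin, so its exponential has the same differential there: the
    terms -h1 and -h2 from [ell] and [theta] recombine into [ulin]. *)
Lemma is_diff_u alpha beta :
  is_diff (0 : R * R)
    (fun x => expR (uexp_re alpha beta x) * cos (uexp_im alpha beta x))
    (fun h => complex.Re (ulin alpha beta (ofR2 h))) /\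
  is_diff (0 : R * R)
    (fun x => expR (uexp_re alpha beta x) * sin (uexp_im alpha beta x))
    (fun h => complex.Im (ulin alpha beta (ofR2 h))).
Proof.
have [re0 im0] := uexp_at0 alpha beta.
have Dr : is_diff (0 : R * R) (uexp_re alpha beta) _ :=
  is_diff_lin3 _ _ _ is_diff_ell0 is_diff_ell is_diff_theta.
have Di : is_diff (0 : R * R) (uexp_im alpha beta) _ :=
  is_diff_lin3 _ _ _ is_diff_ell0 is_diff_ell is_diff_theta.
have De := is_diff_comp1 Dr (is_derive_expR (uexp_re alpha beta 0)).
have Dc := is_diff_comp1 Di (is_derive_cos (uexp_im alpha beta 0)).
have Ds := is_diff_comp1 Di (is_derive_sin (uexp_im alpha beta 0)).
split.
  apply: (is_diff_eqf (is_diffM De Dc)) => // -[h1 h2].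
  rewrite !fctE /= re0 im0 expR0 cos0 sin0 /ulin /ofR2.
  set A := alpha + 1; set B := beta + 1; case: A => a1 a2; case: B => b1 b2.
  by rewrite /GRing.scale /=; ring.
apply: (is_diff_eqf (is_diffM De Ds)) => // -[h1 h2].
rewrite !fctE /= re0 im0 expR0 cos0 sin0 /ulin /ofR2.
set A := alpha + 1; set B := beta + 1; case: A => a1 a2; case: B => b1 b2.
by rewrite /GRing.scale /=; ring.
Qed.

Lemma norm_toR2 z : `|toR2 z| <= cmod z.
Proof. by rewrite /Num.norm /= ge_max Re_le_cmod Im_le_cmod. Qed.

Lemma u_expansion alpha beta (e : R) : 0 < e ->
  exists2 d, 0 < d & forall z, cmod z < d ->
    cmod (u alpha beta z - 1 - ulin alpha beta z) <= e * cmod z.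
Proof.
move=> e0; have [Dr Di] := is_diff_u alpha beta.
have e2 : 0 < e / 2 by rewrite divr_gt0.
have [d1 d10 H1] := is_diff_littleo Dr e2.
have [d2 d20 H2] := is_diff_littleo Di e2.
(* The bound 1 keeps z in the disc, where [uE] holds. *)
exists (Num.min 1 (Num.min d1 d2)); first by rewrite !lt_min ltr01 d10.
move=> z; rewrite !lt_min => /and3P[z1 zd1 zd2].
have n1 := le_lt_trans (norm_toR2 z) zd1; have n2 := le_lt_trans (norm_toR2 z) zd2.
have := H1 _ n1; have := H2 _ n2; rewrite addr0.
have [-> ->] := uexp_at0 alpha beta.
rewrite expR0 cos0 sin0 mulr0 subr0 mulr1 => I2 I1.
have oz : ofR2 (toR2 z) = z by case: (z).
rewrite oz in I1 I2.
rewrite (le_trans (cmod_le_ReIm _))// uE// [e]splitr mulrDl lerD//.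
  apply: le_trans (le_trans I1 _).
    by rewrite [in leLHS]raddfB [in leLHS]raddfB.
  by rewrite ler_wpM2l ?norm_toR2// ltW.
apply: le_trans (le_trans I2 _).
  by rewrite [in leLHS]raddfB [in leLHS]raddfB /= subr0.
by rewrite ler_wpM2l ?norm_toR2// ltW.
Qed.

Lemma cmeasurable_u alpha beta (w : measurableTypeR R -> R[i]) : cmeasurable w ->
  (forall t, cmod (w t) < 1) -> cmeasurable (fun t => u alpha beta (w t)).
Proof.
move=> [mr mi] w1.
have m1 : measurable_fun setT (fun t => 1 - complex.Re (w t)) by exact: measurable_funB.
have ml0 : measurable_fun setT (fun t => ell0 (toR2 (w t))).
  apply: (@measurableT_comp _ _ _ _ _ _ (@ln R)) => //.
  by apply: measurable_funB => //; apply: measurable_funD; exact: measurable_funM.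
have ml : measurable_fun setT (fun t => ell (toR2 (w t))).
  apply: (@measurableT_comp _ _ _ _ _ _ (@ln R)) => //.
  apply: (@measurableT_comp _ _ _ _ _ _ (@Num.sqrt R)).
    exact: continuous_measurable_fun (@sqrt_continuous R).
  by apply: measurable_funD; exact: measurable_funM.
have mt : measurable_fun setT (fun t => theta (toR2 (w t))).
  apply: (@measurableT_comp _ _ _ _ _ _ (@atan R)).
    by apply: continuous_measurable_fun => x; exact: continuous_atan.
  apply: measurable_funM; first exact: measurableT_comp.
  (* The denominator 1 - Re w is positive, so its inverse is the real power of exponent -1. *)
  under eq_fun => t do rewrite -powR_inv1 ?ltW ?cmod_lt1_Re//.
  exact: (@measurableT_comp _ _ _ _ _ _ (@powR R ^~ (-1))).
have me c1 c2 c3 : measurable_fun setT (fun t => c1 * ell0 (toR2 (w t)) +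
    c2 * ell (toR2 (w t)) + c3 * theta (toR2 (w t))).
  by apply: measurable_funD; [apply: measurable_funD|]; apply: measurable_funM.
have uw t := uE alpha beta (w1 t).
under eq_fun do rewrite uw.
have mexp : measurable_fun setT (fun t => expR (uexp_re alpha beta (toR2 (w t)))).
  apply: (@measurableT_comp _ _ _ _ _ _ (@expR R)); first exact: measurable_expR.
  exact: me.
split; apply: measurable_funM => //.
  apply: (@measurableT_comp _ _ _ _ _ _ (@cos R)); last exact: me.
  exact: continuous_measurable_fun (@continuous_cos R).
apply: (@measurableT_comp _ _ _ _ _ _ (@sin R)); last exact: me.
exact: continuous_measurable_fun (@continuous_sin R).
Qed.

End kernel.

(** * Differential of the Poisson integral at the origin *)

Section scaled_measures.
Context d (T : measurableType d) {R : realType}.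
Variables (m : {measure set T -> \bar R}) (k : {nonneg R}).

Lemma integrable_mscale (f : T -> \bar R) :
  m.-integrable setT f -> (mscale k m).-integrable setT f.
Proof.
move=> /integrableP[mf fi]; apply/integrableP; split => //.
rewrite ge0_integral_mscale//; last exact: measurableT_comp.
by apply: lte_mul_pinfty; rewrite ?lee_fin.
Qed.

Lemma integrable_mscaleV (f : T -> \bar R) : 0 < k%:num ->
  (mscale k m).-integrable setT f -> m.-integrable setT f.
Proof.
move=> k0 /integrableP[mf]; rewrite ge0_integral_mscale//; last exact: measurableT_comp.
move=> fi; apply/integrableP; split => //.
move: fi; case: (integral _ _ _) => //=.
  by move=> r _; exact: ltry.
by rewrite gt0_muley ?lte_fin.
Qed.

Lemma Rintegral_mscale (f : T -> R) : m.-integrable setT (EFin \o f) ->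
  \int[mscale k m]_t f t = k%:num * \int[m]_t f t.
Proof.
move=> fi; have mf := measurable_int _ fi.
rewrite /Rintegral -[RHS]/(fine k%:num%:E * _) -fineM//; last first.
  exact: integrable_fin_num.
congr fine; rewrite integralE ge0_integral_mscale//; last exact: measurable_funepos.
rewrite ge0_integral_mscale//; last exact: measurable_funeneg.
by rewrite [in RHS]integralE [RHS]muleBr//; exact: (integrable_add_def measurableT fi).
Qed.

End scaled_measures.

(** * Arc length and its positive multiples *)

Section arc_measures.
Context {R : realType}.
Local Notation T := (measurableTypeR R).
Local Notation D := `[- (pi : R), pi]%classic.
Implicit Types (k : {nonneg R}).

(** The complement of [-pi, pi] is null for the restricted measure, and on subsets of that interval
    it agrees with Lebesgue measure. *)
Lemma ge0_integral_arc (f : T -> \bar R) : measurable_fun setT f ->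
  (forall t, 0 <= f t)%E ->
  (\int[arc_measure]_t f t = \int[lebesgue_measure]_(t in D) f t)%E.
Proof.
move=> mf f0.
have mD : measurable D by exact: measurable_itv.
have -> : (\int[arc_measure]_t f t = \int[arc_measure]_(t in setT `\` ~` D) f t)%E.
  apply: ge0_negligible_integral => //; first exact: measurableC.
  by rewrite /arc_measure /= /mrestr setICl measure0.
rewrite setTD setCK; apply: eq_measure_integral => A mA AD.
by rewrite /arc_measure /= /mrestr setIidl.
Qed.

Lemma ge0_integral_mscale_arc k (f : T -> \bar R) : measurable_fun setT f ->
  (forall t, 0 <= f t)%E ->
  (\int[mscale k arc_measure]_t f t =
   k%:num%:E * \int[lebesgue_measure]_(t in D) f t)%E.
Proof. by move=> mf f0; rewrite ge0_integral_mscale// ge0_integral_arc. Qed.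

Lemma arc_measureT : arc_measure [set: T] = (2 * pi)%:E.
Proof.
rewrite /arc_measure /= /mrestr setTI lebesgue_measure_itv /= lte_fin.
by rewrite gtrN ?pi_gt0// -EFinD opprK mulr_natl.
Qed.

Lemma mscale_arc_lty k : (mscale k arc_measure [set: T] < +oo)%E.
Proof. by rewrite /mscale arc_measureT -EFinM ltry. Qed.

Lemma cintegrable_mscale_arc k (g : T -> R[i]) : 0 < k%:num ->
  cintegrable (mscale k arc_measure) g -> cintegrable arc_measure g.
Proof. by move=> k0 [gr gi]; split; apply: (integrable_mscaleV k0). Qed.

Lemma Cintegral_mscale k (mu : {measure set T -> \bar R}) (g : T -> R[i]) :
  cintegrable mu g ->
  Cintegral (mscale k mu) setT g = (k%:num)%:C * Cintegral mu setT g.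
Proof.
move=> [gr gi]; rewrite /Cintegral !Rintegral_mscale//.
by apply/eqP; rewrite eq_complex /=; apply/andP; split; apply/eqP; ring.
Qed.

(** Trades the measure in [Poisson] for the one that defines the unit ball; this is the origin of
    the constant 1 / (2 pi k). *)
Lemma Cintegral_circle k (g : T -> R[i]) : 0 < k%:num ->
  cintegrable (mscale k arc_measure) g ->
  Cintegral circle_measure setT g =
  (2 * pi * k%:num)^-1%:C * Cintegral (mscale k arc_measure) setT g.
Proof.
move=> k0 /(cintegrable_mscale_arc k0) gi.
rewrite !Cintegral_mscale// mulrA -rmorphM; congr (_%:C * _) => /=.
by rewrite [in RHS]invfM divfK ?gt_eqF.
Qed.

Lemma mscale1_arc : mscale (NngNum (@ler01 R)) arc_measure = arc_measure
  :> {measure set T -> \bar R}.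
Proof. by apply/eq_measure/funext => A; exact: mul1e. Qed.

End arc_measures.

(** * Differentiation under the integral sign *)

Section differential_at0.
Context {R : realType}.
Local Notation V := (R * R)%type.

(** The bound makes [df] continuous and the last hypothesis is the little-o expansion unfolded;
    together they determine the differential. *)
Lemma diff0_unique (f df : V -> V) (M : R) : linear df ->
  (forall h, `|df h| <= M * `|h|) ->
  (forall e : R, 0 < e -> exists2 d : R, 0 < d &
    forall h, `|h| < d -> `|f h - f 0 - df h| <= e * `|h|) ->
  'd f (0 : V) = df :> (V -> V).
Proof.
move=> l dfM H.
pose lM := GRing.isLinear.Build _ _ _ _ _ l.
pose L : {linear V -> V} := HB.pack df lM.
apply: (@diff_unique _ _ _ f L).
  apply/linear_bounded_continuous/linear_boundedP.
  near=> r => h; apply: le_trans (dfM h) _.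
  by rewrite ler_wpM2r//; near: r; apply: nbhs_pinfty_ge; rewrite num_real.
apply/eqaddoP => e e0; have [d d0 Hd] := H _ e0.
apply/nbhs_ballP; exists d => //= h; rewrite -ball_normE /= sub0r normrN => hd.
by rewrite !fctE /= opprD addrA addr0; exact: Hd.
Unshelve. all: by end_near. Qed.

Implicit Types (alpha beta z w : R[i]) (g : R -> R[i]).
Local Notation T := (measurableTypeR R).

(** The kernel K_w of the overview, at the point zeta = [eit t]. *)
Definition dkernel alpha beta w (t : R) : R[i] := ulin alpha beta (w * conjc (eit t)).

Lemma ulinD alpha beta z w : ulin alpha beta (z + w) = ulin alpha beta z + ulin alpha beta w.
Proof. by rewrite /ulin rmorphD /= !mulrDr addrACA. Qed.

Lemma ulinZ alpha beta (a : R) z : ulin alpha beta (a%:C * z) = a%:C * ulin alpha beta z.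
Proof.
have aJ : conjc (a%:C * z) = a%:C * conjc z.
  by rewrite rmorphM; congr (_ * _); exact: conjc_real.
by rewrite /ulin aJ mulrDr !(mulrCA _ a%:C).
Qed.

Lemma dkernelD alpha beta z w t : dkernel alpha beta (z + w) t =
  dkernel alpha beta z t + dkernel alpha beta w t.
Proof. by rewrite /dkernel mulrDl ulinD. Qed.

Lemma dkernelZ alpha beta (a : R) z t : dkernel alpha beta (a%:C * z) t =
  a%:C * dkernel alpha beta z t.
Proof. by rewrite /dkernel -mulrA ulinZ. Qed.

Lemma cmod_ulin alpha beta z :
  cmod (ulin alpha beta z) <= (cmod (alpha + 1) + cmod (beta + 1)) * cmod z.
Proof. by rewrite (le_trans (cmodD _ _))// !cmodM cmod_conjc mulrDl. Qed.

Lemma cmod_mul_eit z t : cmod (z * conjc (eit t)) = cmod z.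
Proof. by rewrite cmodM cmod_conjc cmod_eit mulr1. Qed.

Lemma cmeasurable_mul_eit z : cmeasurable (fun t : T => z * conjc (eit t)).
Proof.
apply: cmeasurableM; first exact: cmeasurable_cst.
exact/cmeasurable_conjc/cmeasurable_eit.
Qed.

Lemma cmeasurable_dkernel alpha beta z : cmeasurable (dkernel alpha beta z : T -> _).
Proof.
by apply: cmeasurableD; apply: cmeasurableM; try exact: cmeasurable_cst;
  try apply: cmeasurable_conjc; exact: cmeasurable_mul_eit.
Qed.

Lemma cmod_dkernel alpha beta z t :
  cmod (dkernel alpha beta z t) <= (cmod (alpha + 1) + cmod (beta + 1)) * cmod z.
Proof. by rewrite (le_trans (cmod_ulin _ _ _))// cmod_mul_eit. Qed.

Lemma toR2B z w : toR2 (z - w) = toR2 z - toR2 w.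
Proof. by case: z; case: w. Qed.

Lemma cmod_le_norm (h : V) : cmod (ofR2 h) <= 2 * `|h|.
Proof.
rewrite (le_trans (cmod_le_ReIm _))// mulr_natl mulr2n.
by rewrite {2}/Num.norm /= {3}/Num.norm /= lerD// le_max lexx ?orbT.
Qed.

Lemma u_at0 alpha beta : u alpha beta 0 = 1.
Proof.
rewrite uE ?cmod0//; have [] := uexp_at0 alpha beta.
rewrite [toR2 0](_ : _ = 0)// => -> ->.
by rewrite /cexp /= expR0 cos0 sin0 mulr1 mulr0.
Qed.

(** The remainder of [u] at z conj(zeta) is at most e1 |z| whatever zeta is; integrated against
    |phi| it stays o(|z|), so the linear term can be integrated on its own. *)
Lemma Dreal_Poisson alpha beta (phi : R[i] -> R[i]) w :
  cintegrable circle_measure (fun t => phi (eit t)) ->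
  Dreal (Poisson alpha beta phi) 0 w =
  cab alpha beta *
    Cintegral circle_measure setT (fun t => dkernel alpha beta w t * phi (eit t)).
Proof.
set g := (fun t => phi (eit t)); set mu := circle_measure; set c := cab alpha beta.
set N := cmod (alpha + 1) + cmod (beta + 1) => gi.
have kgi z : cintegrable mu (fun t => dkernel alpha beta z t * g t).
  apply: (cintegrableMl (cmeasurable_dkernel _ _ _) _ gi) => t; exact: cmod_dkernel.
have [mg cg] := (cintegrableP _ _).1 gi.
set G := \int[mu]_t cmod (g t).
have G0 : 0 <= G by apply: Rintegral_ge0 => t _; exact: cmod_ge0.
pose L z := c * Cintegral mu setT (fun t => dkernel alpha beta z t * g t).
have LD y z : L (y + z) = L y + L z.
  rewrite /L -mulrDr -CintegralD//; congr (_ * _); apply: eq_Cintegral => t.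
  by rewrite -mulrDl -dkernelD.
have LZ (a : R) z : L (a%:C * z) = a%:C * L z.
  rewrite /L mulrCA -(CintegralZl a%:C (kgi z)); congr (_ * _); apply: eq_Cintegral => t.
  by rewrite mulrA -dkernelZ.
have LN z : cmod (L z) <= (cmod c * (N * G)) * cmod z.
  rewrite cmodM -mulrA ler_wpM2l ?cmod_ge0//.
  rewrite (le_trans (le_cmod_Cintegral (kgi _)))// mulrAC.
  rewrite /G -RintegralZl//; apply: le_Rintegral => //.
  - by have [] := (cintegrableP _ _).1 (kgi z).
  - rewrite (_ : EFin \o _ = fun t => ((N * cmod z)%:E * (cmod (g t))%:E)%E)//.
    exact: integrableZl.
  - by move=> t _; rewrite cmodM ler_wpM2r ?cmod_ge0// cmod_dkernel.
have cR2 : cancel (@toR2 R) (@ofR2 R) by case.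
rewrite /Dreal.
rewrite (_ : 'd _ _ = (fun h => toR2 (L (ofR2 h))) :> (V -> V)); first by rewrite !cR2.
rewrite [toR2 0](_ : _ = 0)//.
apply: (@diff0_unique _ _ (cmod c * (N * G) * 2)).
- move=> a x y.
  have -> : ofR2 (a *: x + y) = a%:C * ofR2 x + ofR2 y.
    by case: x y => x1 x2 [y1 y2]; apply/eqP; rewrite eq_complex /= !mul0r addr0 subr0 !eqxx.
  rewrite LD LZ; case: (L _) => p1 p2; case: (L _) => q1 q2; congr pair => /=.
    by rewrite mul0r subr0.
  by rewrite mul0r addr0.
- move=> h; rewrite (le_trans (norm_toR2 _))// (le_trans (LN _))//.
  rewrite -[leRHS]mulrA ler_wpM2l ?cmod_le_norm// !mulr_ge0 ?addr_ge0 ?cmod_ge0//.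
move=> e e0.
(* The 2 pays for |z| <= 2 |h|, the passage from the max norm to the modulus; the + 1 keeps the
   denominator positive when |c| G = 0. *)
pose e1 := e / (2 * (cmod c * G + 1)).
have cG1 : 0 < cmod c * G + 1 by rewrite ltr_wpDl// mulr_ge0// cmod_ge0.
have e10 : 0 < e1 by rewrite divr_gt0// mulr_gt0.
have [d d0 Hd] := u_expansion alpha beta e10.
(* The same factor 2 ensures |z| < d for the expansion and |z| < 1 for the measurability of [u]. *)
exists (Num.min d 1 / 2); first by rewrite divr_gt0// lt_min d0/=.
move=> h; rewrite ltr_pdivlMr// mulrC => /(le_lt_trans (cmod_le_norm h)).
set z := ofR2 h; rewrite lt_min => /andP[zd z1].
pose r t := u alpha beta (z * conjc (eit t)) - 1 - dkernel alpha beta z t.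
have rb t : cmod (r t) <= e1 * cmod z.
  by rewrite /r /dkernel (le_trans (Hd _ _)) ?cmod_mul_eit.
have mr : cmeasurable (r : T -> _).
  apply: cmeasurableD; first apply: cmeasurableD.
  - by apply: cmeasurable_u; [exact: cmeasurable_mul_eit|move=> t; rewrite cmod_mul_eit].
  - exact: cmeasurable_cst.
  - apply: (@eq_ind _ (fun t => -1 * dkernel alpha beta z t) (@cmeasurable R)); last first.
      by apply/funext => t; rewrite mulN1r.
    by apply: cmeasurableM; [exact: cmeasurable_cst|exact: cmeasurable_dkernel].
have rgi : cintegrable mu (fun t => r t * g t) by exact: (cintegrableMl mr rb gi).
have P0 : Poisson alpha beta phi (ofR2 0) = c * Cintegral mu setT g.
  rewrite /Poisson -CintegralZl//; apply: eq_Cintegral => t.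
  by rewrite [ofR2 0](_ : _ = 0)// mul0r u_at0 mulr1.
have Pz : Poisson alpha beta phi z =
    c * Cintegral mu setT g + L z + c * Cintegral mu setT (fun t => r t * g t).
  rewrite /L -!mulrDr -!CintegralD//; last exact: cintegrableD.
  rewrite -CintegralZl; last by do 2 apply: cintegrableD => //.
  apply: eq_Cintegral => t; rewrite /r -/c -mulrA; congr (_ * _).
  by rewrite -/(g t); ring.
rewrite -!toR2B Pz P0 (le_trans (norm_toR2 _))//.
rewrite (_ : _ - _ = c * Cintegral mu setT (fun t => r t * g t)); last by ring.
rewrite cmodM (le_trans (ler_wpM2l (cmod_ge0 _) (le_cmod_Cintegral rgi)))//.
have I1 : \int[mu]_t cmod (r t * g t) <= e1 * cmod z * G.
  rewrite /G -RintegralZl//; apply: le_Rintegral => //.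
  - by have [] := (cintegrableP _ _).1 rgi.
  - rewrite (_ : EFin \o _ = fun t => ((e1 * cmod z)%:E * (cmod (g t))%:E)%E)//.
    exact: integrableZl.
  - by move=> t _; rewrite cmodM ler_wpM2r ?cmod_ge0.
rewrite (le_trans (ler_wpM2l (cmod_ge0 _) I1))//.
have -> : cmod c * (e1 * cmod z * G) = (cmod c * G * e1) * cmod z by ring.
have I2 : cmod c * G * e1 <= e / 2.
  have -> : cmod c * G * e1 = (e / 2) * ((cmod c * G) / (cmod c * G + 1)).
    by rewrite /e1 invfM; ring.
  apply: ler_piMr; first by rewrite divr_ge0// ltW.
  by rewrite ler_pdivrMr// mul1r lerDl.
rewrite (le_trans (ler_pM _ _ I2 (cmod_le_norm h)))//.
- by apply: mulr_ge0; [rewrite mulr_ge0 ?cmod_ge0|exact: ltW].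
- exact: cmod_ge0.
- by rewrite mulrA divfK// pnatr_eq0.
Qed.

End differential_at0.

(** * Integrals of periodic functions *)

Section periodic.
Context {R : realType}.
Implicit Types (g : R -> R) (a x y z : R).
Local Notation leb := (@lebesgue_measure R).

Lemma continuous_itv_integrable g x y : continuous g ->
  leb.-integrable `[x, y] (EFin \o g).
Proof.
move=> cg; apply: continuous_compact_integrable; first exact: segment_compact.
exact: continuous_subspaceT.
Qed.

Lemma Rintegral_shift g a x y : continuous g -> x <= y ->
  \int[leb]_(t in `[x, y]) g (t + a) = \int[leb]_(t in `[x + a, y + a]) g t.
Proof.
move=> cg xy; rewrite /Rintegral; congr fine.
have dF (t : R) : is_derive t (1 : R) (fun s : R => s + a) (1 : R).
  by apply: is_derive_eq; rewrite addr0.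
have DF : (fun s : R => s + a)^`()%classic = cst 1.
  by apply/funext => t; rewrite derive1E; have [_ ->] := dF t.
have cF : continuous (fun s : R => s + a).
  by move=> t; apply: cvgD; [exact: cvg_id|exact: cvg_cst].
rewrite (@integration_by_substitution_increasing _ (fun s : R => s + a) g)//.
- by apply: eq_integral => t _; rewrite DF /= !fctE mulr1.
- by move=> s t _ _; rewrite ltrD2r.
- by move=> t _; rewrite DF; exact: cvg_cst.
- by rewrite DF; exact: is_cvg_cst.
- by rewrite DF; exact: is_cvg_cst.
- split; first by move=> t _; have [] := dF t.
  + exact: cvg_at_right_filter (cF x).
  + exact: cvg_at_left_filter (cF y).
- exact: continuous_subspaceT.
Qed.

Lemma Rintegral_chasles g x y z : continuous g -> x <= y -> y <= z ->
  \int[leb]_(t in `[x, z]) g t =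
  \int[leb]_(t in `[x, y]) g t + \int[leb]_(t in `[y, z]) g t.
Proof.
move=> cg xy yz; apply/eqP; rewrite addrC -subr_eq; apply/eqP.
rewrite Rintegral_itvB ?bnd_simp//; last exact: continuous_itv_integrable.
rewrite Rintegral_itv_obnd_cbnd//.
apply: integrableS (continuous_itv_integrable y z cg) => //.
by apply: subset_itvr; rewrite bnd_simp.
Qed.

(** The shift moves the window to [x + a, x + p + a]; its part beyond x + p is [x, x + a] translated
    by the period. *)
Let Rintegral_period_ge0 g a x p : continuous g -> (forall t, g (t + p) = g t) ->
  0 <= a <= p ->
  \int[leb]_(t in `[x, x + p]) g (t + a) = \int[leb]_(t in `[x, x + p]) g t.
Proof.
move=> cg gp /andP[a0 ap].
have p0 : 0 <= p by exact: le_trans ap.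
rewrite Rintegral_shift ?lerDl//.
rewrite (@Rintegral_chasles g (x + a) (x + p)) ?lerD2l// ?lerDl//.
rewrite (@Rintegral_chasles g x (x + a) (x + p)) ?lerD2l// ?lerDl//.
rewrite addrC; congr (_ + _).
rewrite -[x + p + a]addrAC -Rintegral_shift ?lerDl//.
by apply: eq_Rintegral => t _; rewrite gp.
Qed.

Lemma Rintegral_period g a x p : continuous g -> (forall t, g (t + p) = g t) ->
  `|a| <= p ->
  \int[leb]_(t in `[x, x + p]) g (t + a) = \int[leb]_(t in `[x, x + p]) g t.
Proof.
move=> cg gp; have [a0|a0] := leP 0 a => ap.
  by apply: Rintegral_period_ge0 => //; rewrite a0 -(ger0_norm a0).
(* For a < 0, the shifted function is periodic as well, and the nonnegative shift -a brings it back
   to [g]. *)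
rewrite -(@Rintegral_period_ge0 (fun t => g (t + a)) (- a)).
- by apply: eq_Rintegral => t _; rewrite subrK.
- move=> t; apply: (@continuous_comp _ _ _ (fun t : R => t + a) g); last exact: cg.
  by apply: cvgD; [exact: cvg_id|exact: cvg_cst].
- by move=> t; rewrite addrAC gp.
- by rewrite oppr_ge0 (ltW a0) -(ltr0_norm a0).
Qed.

End periodic.

(** * Hoelder's inequality and its extremal functions *)

Section duality.
Context {R : realType}.
Local Notation T := (measurableTypeR R).
Local Notation D := `[- (pi : R), pi]%classic.
Local Notation leb := (@lebesgue_measure R).
Variables (k : {nonneg R}) (k0 : 0 < k%:num).
Local Notation mu := (mscale k (@arc_measure R)).
Implicit Types (h : T -> R) (f : T -> R[i]) (p q : \bar R).

Lemma conjugate_cases p q : (1 <= p)%E -> (1 <= q)%E -> (p^-1 + q^-1 = 1)%E ->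
  [\/ p = +oo%E /\ q = 1%E, p = 1%E /\ q = +oo%E |
   exists r s, [/\ p = r%:E, q = s%:E, 1 < r, 1 < s & r^-1 + s^-1 = 1]].
Proof.
case: p => [r| |//]; case: q => [s| |//].
- rewrite !lee_fin => r1 s1.
  have r0 : 0 < r by exact: lt_le_trans r1.
  have s0 : 0 < s by exact: lt_le_trans s1.
  rewrite !inver !gt_eqF// -EFinD => -[rs]; apply: Or33; exists r, s; split => //.
    by rewrite -invf_lt1// -rs ltrDl invr_gt0.
  by rewrite -invf_lt1// -rs ltrDr invr_gt0.
- by move=> _ _; rewrite invey adde0 => /eqP; rewrite inve_eq1 => /eqP ->; exact: Or32.
- by move=> _ _; rewrite invey add0e => /eqP; rewrite inve_eq1 => /eqP ->; exact: Or31.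
- by move=> _ _; rewrite invey adde0 => /eqP; rewrite eq_sym onee_eq0.
Qed.

Lemma measurable_powR_comp h (r : R) : measurable_fun setT h ->
  measurable_fun setT (fun t => h t `^ r).
Proof. exact: (@measurableT_comp _ _ _ _ _ _ (@powR R ^~ r)). Qed.

Lemma Rintegral_fin h (M : R) : measurable_fun setT h -> (forall t, 0 <= h t <= M) ->
  ((\int[leb]_(t in D) h t)%R%:E = \int[leb]_(t in D) (h t)%:E)%E.
Proof.
move=> mh hM; rewrite /Rintegral fineK//; apply: integrable_fin_num => //.
apply: measurable_bounded_integrable => //.
- suff : (leb (D : set R) < +oo)%E by [].
  by rewrite lebesgue_measure_itv /=; case: ifP => // _; rewrite -EFinD ltry.
- exact: measurable_funTS.
- exists M; split; first exact: num_real.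
  move=> x Mx t _ /=; have /andP[h0 h1] := hM t.
  by rewrite ger0_norm// (le_trans h1)// ltW.
Qed.

Lemma integral_mscale_arc h (M : R) : measurable_fun setT h -> (forall t, 0 <= h t <= M) ->
  (\int[mu]_t (h t)%:E = (k%:num * \int[leb]_(t in D) h t)%R%:E)%E.
Proof.
move=> mh hM; rewrite ge0_integral_mscale_arc//.
- by rewrite EFinM (Rintegral_fin mh hM).
- exact/measurable_EFinP.
- by move=> t; rewrite lee_fin; have /andP[] := hM t.
Qed.

Lemma powR_bound h (M r : R) : 0 <= r -> (forall t, 0 <= h t <= M) ->
  forall t, 0 <= h t `^ r <= M `^ r.
Proof.
move=> r0 hM t; have /andP[h0 h1] := hM t.
rewrite powR_ge0/= ge0_ler_powR// nnegrE//; exact: le_trans h1.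
Qed.

Lemma Lnorm_qmean h (M r : R) : 0 <= r -> measurable_fun setT h -> (forall t, 0 <= h t <= M) ->
  Lnorm mu r%:E (fun t => (h t)%:E) = (qmean k%:num r%:E h)%:E.
Proof.
move=> r0 mh hM; rewrite unlock /qmean.
rewrite -poweR_EFin; congr (_ `^ _)%E.
rewrite -(integral_mscale_arc (measurable_powR_comp r mh) (powR_bound r0 hM)).
by apply: eq_integral => t _; rewrite /= ger0_norm//; have /andP[] := hM t.
Qed.

Lemma mscale_arcT_gt0 : (0 < mu [set: T])%E.
Proof. by rewrite /mscale arc_measureT -EFinM lte_fin !mulr_gt0 ?pi_gt0. Qed.

(** Stated in extended reals, so that h = 1 yields the integrability of functions in the ball. The
    endpoint exponents are treated directly, because for p = 1 the other factor is the pointwise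
    supremum of h over [-pi, pi] and not an essential supremum. *)
Lemma hoelder_ball h f p q (M : R) :
  (1 <= p)%E -> (1 <= q)%E -> (p^-1 + q^-1 = 1)%E ->
  measurable_fun setT h -> (forall t, 0 <= h t <= M) -> cmeasurable f ->
  (Lnorm mu p (fun t => (cmod (f t))%:E) <= 1)%E ->
  (\int[mu]_t (h t * cmod (f t))%:E <= (qmean k%:num q h)%:E)%E.
Proof.
move=> p1 q1 pq mh hM mf f1.
have h0 t : 0 <= h t by have /andP[] := hM t.
have mc := measurable_cmod mf.
have mhc : measurable_fun setT (fun t => (h t * cmod (f t))%:E).
  by apply/measurable_EFinP; exact: measurable_funM.
case: (conjugate_cases p1 q1 pq) => [[pE qE]|[pE qE]|[r [s [pE qE r1 s1 rs]]]].
(* The norm for p = +oo is the essential supremum provided the total mass is positive. *)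
- move: f1; rewrite pE unlock mscale_arcT_gt0 => /ess_supP f1.
  apply: (@le_trans _ _ (\int[mu]_t (h t)%:E)%E).
    apply: ae_ge0_le_integral => //.
    + by move=> t _; rewrite lee_fin mulr_ge0 ?cmod_ge0.
    + by move=> t _; rewrite lee_fin.
    + exact/measurable_EFinP.
    + apply: filterS f1 => t /= + _; rewrite !lee_fin (ger0_norm (cmod_ge0 _)) => ft.
      by rewrite ler_piMr.
  rewrite (integral_mscale_arc mh hM) qE /qmean invr1 powRr1; last first.
    by rewrite mulr_ge0// Rintegral_ge0// => t _; rewrite powR_ge0.
  by under [in leRHS]eq_Rintegral do rewrite powRr1//.
- move: f1; rewrite pE qE Lnorm1.
  under eq_integral do rewrite /= ger0_norm ?cmod_ge0//.
  set S := qmean _ _ _ => f1.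
  have S1 t : D t -> h t <= S.
    move=> Dt; apply: ub_le_sup; last by exists t.
    by exists M => _ [x _ <-]; have /andP[] := hM x.
  have S0 : 0 <= S.
    by apply: le_trans (h0 0) (S1 _ _); rewrite /= in_itv/= oppr_le0 pi_ge0.
  rewrite ge0_integral_mscale_arc//; last by move=> t; rewrite lee_fin mulr_ge0 ?cmod_ge0.
  rewrite (@le_trans _ _ (k%:num%:E * (S%:E * \int[leb]_(t in D) (cmod (f t))%:E))%E)//.
    rewrite lee_pmul2l ?lte_fin// -ge0_integralZl//; last 2 first.
    + by apply/measurable_EFinP; exact: measurable_funTS.
    + by move=> t _; rewrite lee_fin cmod_ge0.
    + apply: ge0_le_integral => //.
      * by move=> t _; rewrite lee_fin mulr_ge0 ?cmod_ge0.
      * exact: measurable_funTS.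
      * by apply: emeasurable_funM => //; apply/measurable_EFinP; exact: measurable_funTS.
      * by move=> t Dt; rewrite -EFinM lee_fin ler_wpM2r ?cmod_ge0// S1.
  rewrite muleCA -ge0_integral_mscale_arc//; last 2 first.
  + exact/measurable_EFinP.
  + by move=> t; rewrite lee_fin cmod_ge0.
  by rewrite -[leRHS]mule1 lee_wpmul2l// lee_fin.
have r0 : 0 < r by exact: lt_trans r1.
have s0 : 0 < s by exact: lt_trans s1.
have := hoelder mu mc mh r0 s0 rs.
rewrite Lnorm1 /=; under eq_integral do rewrite /= mulrC ger0_norm ?mulr_ge0 ?cmod_ge0//.
move=> /le_trans; apply; rewrite qE -(Lnorm_qmean (ltW s0) mh hM).
rewrite -[leRHS]mul1e; apply: lee_wpmul2r; first exact: Lnorm_ge0.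
by move: f1; rewrite pE.
Qed.

Lemma Lp_ball_cintegrable p q (phi : R[i] -> R[i]) :
  (1 <= p)%E -> (1 <= q)%E -> (p^-1 + q^-1 = 1)%E -> Lp_ball mu p phi ->
  cintegrable mu (fun t => phi (eit t)).
Proof.
move=> p1 q1 pq [mr mi f1]; apply/cintegrableP; split => //.
have mc : cmeasurable (fun t : T => phi (eit t)) by [].
apply/integrableP; split.
  by apply/measurable_EFinP; exact: measurable_cmod.
have h1 (t : T) : 0 <= (cst 1 t : R) <= 1 by rewrite /= ler01 lexx.
have := hoelder_ball p1 q1 pq (@measurable_cst _ _ _ _ _ (1 : R)) h1 mc f1.
under eq_integral do rewrite /= mul1r.
under [in X in _ -> X]eq_integral do rewrite /= ger0_norm ?cmod_ge0//.
by move=> /le_lt_trans; apply; exact: ltry.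
Qed.

End duality.

(** * Functions that attain or approach the Hoelder bound *)

Section extremal.
Context {R : realType}.
Local Notation T := (measurableTypeR R).
Local Notation D := `[- (pi : R), pi]%classic.
Local Notation leb := (@lebesgue_measure R).
Variables (k : {nonneg R}) (k0 : 0 < k%:num).
Local Notation mu := (mscale k (@arc_measure R)).
Variables (kappa : R[i] -> R[i]) (M : R).
Let K (t : T) := kappa (eit t).
Let h (t : T) := cmod (K t).
Hypotheses (mK : cmeasurable K) (hM : forall t, h t <= M).

Let mh : measurable_fun setT h. Proof. exact: measurable_cmod. Qed.

Let h0M t : 0 <= h t <= M. Proof. by rewrite cmod_ge0 hM. Qed.

Lemma Rintegral_mscale_arc (g : T -> R) (B : R) :
  measurable_fun setT g -> (forall t, 0 <= g t <= B) ->
  \int[mu]_t g t = k%:num * \int[leb]_(t in D) g t.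
Proof. by move=> mg gB; rewrite /Rintegral (integral_mscale_arc k mg gB). Qed.

(* [aligned w] has modulus at most [w |kappa|], and its product with [kappa] is
   [|kappa| w |kappa|]: it realizes the equality case of Hoelder's inequality. *)
Definition aligned (w : R -> R) (z : R[i]) : R[i] :=
  conjc (kappa z) * ((cmod (kappa z))^-1 * w (cmod (kappa z)))%:C.

Lemma cmeasurable_aligned (w : R -> R) : measurable_fun setT (w \o h) ->
  cmeasurable (fun t : T => aligned w (eit t)).
Proof.
move=> mw; apply: cmeasurableM; first exact: cmeasurable_conjc.
apply: cmeasurable_real; apply: measurable_funM => //.
under eq_fun do rewrite -powR_inv1 ?cmod_ge0//.
exact: measurable_powR_comp.
Qed.

(** Where [kappa] vanishes, [aligned] is 0, so in general only an inequality holds; a weight with w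
    0 = 0 restores equality. *)
Lemma cmod_aligned w z : (forall x, 0 <= w x) -> cmod (aligned w z) <= w (cmod (kappa z)).
Proof.
move=> w0; rewrite cmodM cmod_conjc cmod_real ger0_norm ?mulr_ge0 ?invr_ge0 ?cmod_ge0//.
have [->|c0] := eqVneq (cmod (kappa z)) 0; first by rewrite mul0r.
by rewrite mulrA mulfV// mul1r.
Qed.

Lemma cmod_aligned0 w z : (forall x, 0 <= w x) -> w 0 = 0 ->
  cmod (aligned w z) = w (cmod (kappa z)).
Proof.
move=> w0 w00; rewrite cmodM cmod_conjc cmod_real ger0_norm ?mulr_ge0 ?invr_ge0 ?cmod_ge0//.
have [->|c0] := eqVneq (cmod (kappa z)) 0; first by rewrite mul0r.
by rewrite mulrA mulfV// mul1r.
Qed.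

Lemma Cintegral_aligned w :
  Cintegral mu setT (fun t => K t * aligned w (eit t)) =
  (\int[mu]_t (h t * w (h t)))%:C.
Proof.
have E t : K t * aligned w (eit t) = (h t * w (h t))%:C.
  rewrite mulrA mulc_conj -rmorphM; congr (_%:C); rewrite -/(h t) expr2 /=.
  have [->|c0] := eqVneq (h t) 0; first by rewrite !mul0r.
  by rewrite mulrA mulfK.
rewrite (eq_Cintegral _ E) /Cintegral /=; congr (_ +i* _).
by rewrite Rintegral_cst// mul0r.
Qed.

Lemma aligned_Lp_ball (w : R -> R) p : measurable_fun setT (w \o h) ->
  (Lnorm mu p (fun t => (cmod (aligned w (eit t)))%:E) <= 1)%E ->
  Lp_ball mu p (aligned w).
Proof. by move=> mw Lw; have [mr mi] := cmeasurable_aligned mw; split. Qed.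

(** The suffix is the value of q. With weight 1 the function is the phase of conj(kappa), and the
    pairing is the integral of |kappa|. *)
Lemma extremal_1 : exists2 f, Lp_ball mu +oo%E f &
  qmean k%:num 1%E h <= cmod (Cintegral mu setT (fun t => K t * f (eit t))).
Proof.
pose w (x : R) : R := 1.
exists (aligned w).
  apply: aligned_Lp_ball; [exact: measurable_cst|].
  rewrite unlock (mscale_arcT_gt0 k0).
  apply/ess_supP; apply/nearW => t /=; rewrite lee_fin ger0_norm ?cmod_ge0//.
  exact: (@cmod_aligned w).
rewrite Cintegral_aligned cmod_real /qmean invr1 powRr1; last first.
  by rewrite mulr_ge0// Rintegral_ge0// => t _; rewrite powR_ge0.
under eq_Rintegral do rewrite powRr1 ?cmod_ge0//.
under [in leRHS]eq_Rintegral do rewrite mulr1.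
by rewrite (Rintegral_mscale_arc mh h0M) ler_norm.
Qed.

Lemma extremal_fin (r s : R) : 1 < r -> 1 < s -> r^-1 + s^-1 = 1 ->
  exists2 f, Lp_ball mu r%:E f &
  qmean k%:num s%:E h <= cmod (Cintegral mu setT (fun t => K t * f (eit t))).
Proof.
move=> r1 s1 rs.
have r0 : 0 < r by exact: lt_trans r1.
have s0 : 0 < s by exact: lt_trans s1.
have s10 : 0 < s - 1 by rewrite subr_gt0.
have sr : (s - 1) * r = s.
  apply: (@mulfI _ s^-1); first by rewrite gt_eqF// invr_gt0.
  rewrite mulVf ?gt_eqF// mulrA mulrBr mulVf ?gt_eqF// mulr1.
  by rewrite -{1}rs addrK mulVf ?gt_eqF.
set J := k%:num * \int[leb]_(t in D) (h t `^ s).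
have J0 : 0 <= J by rewrite mulr_ge0// Rintegral_ge0// => t _; rewrite powR_ge0.
pose Q := J `^ s^-1.
(* Since (s - 1) r = s, this normalization gives w^r = h^s / J, of integral 1, and the pairing is J
   / Q^(s-1) = Q. *)
pose w x := x `^ (s - 1) / Q `^ (s - 1).
have w0 x : 0 <= w x by rewrite divr_ge0 ?powR_ge0.
have mw : measurable_fun setT (w \o h).
  by apply: measurable_funM => //; exact: measurable_powR_comp.
have Js : Q `^ s = J by rewrite /Q -powRrM mulVf ?gt_eqF// powRr1.
have wr t : w (h t) `^ r = h t `^ s * J^-1.
  rewrite /w powRM ?powR_ge0 ?invr_ge0 ?powR_ge0//.
  rewrite -powRrM sr; congr (_ * _); transitivity (Q `^ (s * -1)).
    by rewrite -powR_inv1 ?powR_ge0// -!powRrM; congr (_ `^ (_ * _)); rewrite -[in RHS]sr; ring.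
  by rewrite powRrM Js powR_inv1.
have bs := powR_bound (ltW s0) h0M.
have ms := measurable_powR_comp s mh.
have intD : leb.-integrable D (EFin \o (fun t => h t `^ s)).
  apply: measurable_bounded_integrable => //.
  - suff : (leb (D : set R) < +oo)%E by [].
    by rewrite lebesgue_measure_itv /=; case: ifP => // _; rewrite -EFinD ltry.
  - exact: measurable_funTS.
  - exists (M `^ s); split; first exact: num_real.
    move=> x Mx t _ /=; have /andP[b0 b1] := bs t.
    by rewrite ger0_norm// (le_trans b1)// ltW.
exists (aligned w).
  apply: aligned_Lp_ball => //.
  have -> : (fun t : T => (cmod (aligned w (eit t)))%:E) = (fun t => (w (h t))%:E).
    apply/funext => t; congr EFin.
    by rewrite cmod_aligned0// /w powR0 ?mul0r// gt_eqF.
  have wB (x : T) : 0 <= w (h x) <= M `^ (s - 1) / Q `^ (s - 1).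
    rewrite w0/= ler_wpM2r ?invr_ge0 ?powR_ge0//.
    by have /andP[] := powR_bound (ltW s10) h0M x.
  rewrite (Lnorm_qmean _ (ltW r0) mw wB) lee_fin /qmean.
  under eq_Rintegral do rewrite wr.
  rewrite RintegralZr// mulrA -/J.
  (* J = 0 is allowed: the inverse of 0 being 0, the function then has norm 0, and the value Q to be
     reached is 0. *)
  have [->|Jn] := eqVneq J 0; first by rewrite mul0r powR0 ?invr_eq0 ?gt_eqF.
  by rewrite mulfV// powR1.
rewrite Cintegral_aligned cmod_real /qmean -/J -/Q.
have E t : h t * w (h t) = h t `^ s * (Q `^ (s - 1))^-1.
  by rewrite /w mulrA mulr_powRB1 ?cmod_ge0.
rewrite (le_trans _ (ler_norm _))//.
under eq_Rintegral do rewrite E.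
have EB t : 0 <= h t `^ s * (Q `^ (s - 1))^-1 <= M `^ s * (Q `^ (s - 1))^-1.
  have /andP[b0 b1] := bs t.
  by rewrite mulr_ge0 ?invr_ge0 ?powR_ge0//= ler_wpM2r ?invr_ge0 ?powR_ge0.
rewrite (Rintegral_mscale_arc _ EB); last exact: measurable_funM.
rewrite RintegralZr// mulrA -/J.
have [Q0|Qn] := eqVneq Q 0; first by rewrite Q0 mulr_ge0// invr_ge0 powR_ge0.
rewrite -Js -(@mulr_powRB1 _ Q s) ?powR_ge0// mulfK// powR_eq0.
by rewrite (negbTE Qn).
Qed.

(** The supremum is h 0. The function is the phase of conj(kappa) on the set where h >= h 0 - e,
    divided by the measure [m] of that set, so the pairing is the average of h over it. Continuity
    at 0 makes [m] positive. *)
Lemma extremal_oo (e : R) : {for (0 : R), continuous (h : R -> R)} ->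
  (forall t, h t <= h 0) -> 0 < e ->
  exists2 f, Lp_ball mu 1%E f &
  qmean k%:num +oo%E h - e <= cmod (Cintegral mu setT (fun t => K t * f (eit t))).
Proof.
move=> ch hmax e0.
have D0 : D 0 by rewrite /= in_itv/= oppr_le0 pi_ge0.
have -> : qmean k%:num +oo%E h = h 0.
  apply/eqP; rewrite eq_le; apply/andP; split.
    by apply: ge_sup; [exists (h 0), 0|move=> _ [t _ <-]].
  by apply: ub_le_sup; [exists (h 0) => _ [t _ <-]|exists 0].
pose A := `[h 0 - e, +oo[%classic : set R.
pose g (t : T) : R := \1_A (h t).
have mg : measurable_fun setT g.
  have mA : measurable_fun setT (\1_A : T -> R).
    by apply: measurable_indic; exact: measurable_itv.
  exact: (measurableT_comp mA mh).
have g01 t : 0 <= g t <= 1 by rewrite /g indicE; case: (_ \in _); rewrite /= ?lexx ?ler01.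
set m := \int[mu]_t g t.
have m0 : 0 < m.
  rewrite /m (Rintegral_mscale_arc mg g01) mulr_gt0//.
  move/cvgrPdist_lt : (ch) => /(_ e e0).
  move=> /nbhs_ballP[d /= d0 Hd].
  (* [0, b] lies in [-pi, pi] and, thanks to the half, strictly within distance d of 0. *)
  pose b := Num.min (d / 2) pi.
  have b0 : 0 < b by rewrite lt_min divr_gt0//= pi_gt0.
  apply: (@lt_le_trans _ _ b) => //.
  rewrite -lee_fin (Rintegral_fin mg g01).
  have -> : (b%:E = \int[leb]_(t in D) (\1_(`[0, b]%classic) t)%:E)%E.
    have lb : (leb (`[0%R, b]%classic : set R) = b%:E)%E.
      by rewrite lebesgue_measure_itv /= lte_fin b0 -EFinD subr0.
    rewrite integral_indic// setIidl; first exact/esym/lb.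
    move=> t /=; rewrite !in_itv/= => /andP[t0 tb].
    rewrite (le_trans _ t0) ?oppr_le0 ?pi_ge0//= (le_trans tb)//.
    by rewrite /b ge_min lexx orbT.
  apply: ge0_le_integral => //.
  - by apply/measurable_EFinP; exact: measurable_indic.
  - by apply/measurable_EFinP; exact: measurable_funTS.
  - move=> t _; rewrite lee_fin /g !indicE.
    have [tb|_] := boolP (t \in _); last by rewrite ler0n.
    suff hA : A (h t) by rewrite (mem_set hA).
    rewrite /A /= in_itv/= andbT.
    move: tb; rewrite inE /= in_itv/= => /andP[t0 tb].
    have := Hd t; rewrite -ball_normE /= sub0r normrN ger0_norm// => H.
    have td : t < d.
      rewrite (le_lt_trans tb)// /b gt_min; apply/orP; left.
      by rewrite ltr_pdivrMr// mulr_natr mulr2n ltrDl.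
    have := H td; rewrite ger0_norm ?subr_ge0// => hd.
    by rewrite lerBlDr addrC -lerBlDr ltW.
pose w x : R := \1_A x / m.
have w0 x : 0 <= w x by apply: divr_ge0; [rewrite indicE ler0n|exact: ltW].
have mw : measurable_fun setT (w \o h) by exact: measurable_funM.
have wB t : 0 <= w (h t) <= m^-1.
  rewrite w0/= /w; apply: ler_piMl; first by rewrite invr_ge0 ltW.
  by have /andP[] := g01 t.
have gint : mu.-integrable setT (EFin \o g).
  apply: measurable_bounded_integrable => //; first exact: mscale_arc_lty.
  exists 1; split; first exact: num_real.
  move=> x Mx t _ /=; have /andP[b0 b1] := g01 t.
  by rewrite ger0_norm// (le_trans b1)// ltW.
have Iw : \int[mu]_t w (h t) = 1 by rewrite RintegralZr// -/m mulfV// gt_eqF.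
exists (aligned w).
  apply: aligned_Lp_ball => //; rewrite Lnorm1.
  have <- : (\int[mu]_t (w (h t))%:E = 1)%E.
    by rewrite (integral_mscale_arc _ mw wB) -(Rintegral_mscale_arc mw wB) Iw.
  apply: ge0_le_integral => //.
  - apply/measurable_EFinP; apply: measurableT_comp => //.
    by apply: measurable_cmod; exact: cmeasurable_aligned.
  - exact/measurable_EFinP.
  - by move=> t _; rewrite /= lee_fin ger0_norm ?cmod_ge0//; exact: cmod_aligned.
rewrite Cintegral_aligned cmod_real (le_trans _ (ler_norm _))//.
have wint : mu.-integrable setT (EFin \o (fun t => w (h t))).
  rewrite (_ : EFin \o _ = fun t => ((g t)%:E * (m^-1)%:E)%E)//.
  exact: integrableZr.
rewrite -[leLHS]mulr1 -{1}Iw -RintegralZl//; apply: le_Rintegral => //.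
- rewrite (_ : EFin \o _ = fun t => ((h 0 - e)%:E * (w (h t))%:E)%E)//.
  exact: integrableZl.
- apply: measurable_bounded_integrable => //; first exact: mscale_arc_lty.
    exact: measurable_funM.
  exists (M * m^-1); split; first exact: num_real.
  move=> x Mx t _ /=; have /andP[b0 b1] := wB t; have /andP[c0 c1] := h0M t.
  have -> : `|h t * w (h t)| = h t * w (h t) by apply: ger0_norm; exact: mulr_ge0.
  by apply: le_trans (ltW Mx); exact: ler_pM.
- move=> t _; rewrite /w indicE; have [/set_mem|_] := boolP (h t \in A).
    rewrite /A /= in_itv/= andbT => he.
    by rewrite ler_wpM2r// mul1r invr_ge0 ltW.
  by rewrite mul0r !mulr0.
Qed.

End extremal.

(** * The supremum over the unit ball *)

(** The power is differentiable where g > 0. At a zero of g this may fail, and the threshold e^(1/r)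
    on g is used instead. *)
Lemma continuous_powR_ge0 {R : realType} (g : R -> R) (r : R) : 0 < r ->
  continuous g -> (forall t, 0 <= g t) -> continuous (fun t => g t `^ r).
Proof.
move=> r0 cg g0 t; have := g0 t; rewrite le_eqVlt => /predU1P[gt0|gt0]; last first.
  apply: (@continuous_comp _ _ _ g (fun x => x `^ r)); first exact: cg.
  apply: differentiable_continuous; apply/derivable1_diffP.
  by apply: derivable_powR; rewrite in_itv/= andbT.
apply/cvgrPdist_lt => e e0; rewrite -gt0 powR0 ?gt_eqF//.
have e10 : 0 < e `^ r^-1 by rewrite powR_gt0.
move/cvgrPdist_lt : (cg t) => /(_ _ e10); rewrite -gt0.
apply: filterS => x; rewrite !sub0r !normrN !ger0_norm ?powR_ge0// => gx.
have -> : e = (e `^ r^-1) `^ r by rewrite -powRrM mulVf ?gt_eqF// powRr1// ltW.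
by apply: gt0_ltr_powR; rewrite // nnegrE ?powR_ge0.
Qed.

Section main.
Context {R : realType}.
Local Notation T := (measurableTypeR R).
Local Notation D := `[- (pi : R), pi]%classic.
Local Notation leb := (@lebesgue_measure R).
Variables (alpha beta : R[i]).

Local Notation a := (alpha + 1).
Local Notation b := (beta + 1).

Definition dkernel_mod (t : R) : R := cmod ((cmod a)%:C + (cmod b)%:C * eit (2 * t)).

(** Factor out the phase of the first summand of K_w. The relative phase of the second is Arg b -
    Arg a + 2 (t - s), and half of its constant part is a translation of t. *)
Lemma cmod_dkernel_eit s t :
  cmod (dkernel alpha beta (eit s) t) = dkernel_mod (t + ((cArg b - cArg a) / 2 - s)).
Proof.
have -> : dkernel alpha beta (eit s) t = eit (cArg a + s - t) *
    ((cmod a)%:C + (cmod b)%:C * eit (2 * (t + ((cArg b - cArg a) / 2 - s)))).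
  rewrite /dkernel /ulin conjc_eit -eitD conjc_eit {1}(polar a) {1}(polar b).
  rewrite -!mulrA -!eitD mulrDr (mulrC _ (cmod a)%:C) (mulrCA _ (cmod b)%:C) -eitD.
  by congr (_ * eit _ + _ * eit _); field.
by rewrite cmodM cmod_eit mul1r.
Qed.

Lemma dkernel_mod_le t : dkernel_mod t <= cmod a + cmod b.
Proof.
rewrite (le_trans (cmodD _ _))// cmodM cmod_eit mulr1 !cmod_real.
by rewrite !ger0_norm ?cmod_ge0.
Qed.

Lemma dkernel_mod0 : dkernel_mod 0 = cmod a + cmod b.
Proof.
by rewrite /dkernel_mod mulr0 eit0 mulr1 -rmorphD cmod_real ger0_norm// addr_ge0 ?cmod_ge0.
Qed.

Lemma dkernel_modD2pi t : dkernel_mod (t + 2 * pi) = dkernel_mod t.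
Proof.
rewrite /dkernel_mod; have -> : 2 * (t + 2 * pi) = 2 * t + 2 * pi + 2 * pi by ring.
by rewrite !eitD2pi.
Qed.

Lemma continuous_dkernel_mod : continuous dkernel_mod.
Proof.
have -> : dkernel_mod = fun t => Num.sqrt
    ((cmod a + cmod b * cos (2 * t)) ^+ 2 + (cmod b * sin (2 * t)) ^+ 2).
  by apply/funext => t; rewrite /dkernel_mod cmodE /= !mul0r subr0 addr0 add0r.
have c2 : continuous (fun t : R => 2 * t).
  by move=> t; apply: cvgM; [exact: cvg_cst|exact: cvg_id].
have cc : continuous (fun t : R => cos (2 * t)).
  by move=> t; apply: (@continuous_comp _ _ _ (fun t : R => 2 * t));
    [exact: c2|exact: continuous_cos].
have cs : continuous (fun t : R => sin (2 * t)).
  by move=> t; apply: (@continuous_comp _ _ _ (fun t : R => 2 * t));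
    [exact: c2|exact: continuous_sin].
pose f1 t := cmod a + cmod b * cos (2 * t); pose f2 t := cmod b * sin (2 * t).
have cf1 : continuous f1.
  by move=> t; apply: cvgD; [exact: cvg_cst|apply: cvgM; [exact: cvg_cst|exact: cc]].
have cf2 : continuous f2 by move=> t; apply: cvgM; [exact: cvg_cst|exact: cs].
have cf : continuous (fun t => f1 t ^+ 2 + f2 t ^+ 2).
  by move=> t; under eq_fun do rewrite !expr2; apply: cvgD; apply: cvgM;
    [exact: cf1|exact: cf1|exact: cf2|exact: cf2].
move=> t; apply: (@continuous_comp _ _ _ (fun t => f1 t ^+ 2 + f2 t ^+ 2) (@Num.sqrt R)).
  exact: cf.
exact: sqrt_continuous.
Qed.

(** For finite q this is an equality, by periodicity. For q = +oo the upper bound |a| + |b|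
    suffices, since [dkernel_mod] attains it at 0. *)
Lemma qmean_dkernel k q w : (1 <= q)%E -> cmod w = 1 ->
  qmean k q (fun t => cmod (dkernel alpha beta w t)) <= qmean k q dkernel_mod.
Proof.
move=> q1 w1; have wE : w = eit (cArg w) by rewrite {1}(polar w) w1 mul1r.
set c := (cArg b - cArg a) / 2 - cArg w.
have kE t : cmod (dkernel alpha beta w t) = dkernel_mod (t + c) by rewrite {1}wE cmod_dkernel_eit.
under eq_fun do rewrite kE.
case: q q1 => [r| |//] r1.
  have r0 : 0 < r by rewrite -lte_fin (lt_le_trans _ r1)// lte_fin.
  have -> : qmean k r%:E (fun t => dkernel_mod (t + c)) =
      qmean k r%:E dkernel_mod; last exact: lexx.
  have IE : \int[leb]_(t in `[- pi, pi]) dkernel_mod (t + c) `^ r =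
      \int[leb]_(t in `[- pi, pi]) dkernel_mod t `^ r.
    have piE : - pi + 2 * pi = pi :> R by ring.
    have := @Rintegral_period _ (fun t => dkernel_mod t `^ r) c (- pi) (2 * pi).
    rewrite piE; apply.
    - apply: continuous_powR_ge0 => //; first exact: continuous_dkernel_mod.
      by move=> t; exact: cmod_ge0.
    - by move=> t; rewrite dkernel_modD2pi.
    (* Both (Arg b - Arg a) / 2 and Arg w are at most pi in absolute value, so |c| <= 2 pi. *)
    - have /andP[b1 b2] := cArg_bound b; have /andP[a1 a2] := cArg_bound a.
      have /andP[c1 c2] := cArg_bound w.
      by rewrite ler_norml /c; apply/andP; split; lra.
  by rewrite /qmean IE.
have D0 : D 0 by rewrite /= in_itv/= oppr_le0 pi_ge0.
rewrite /qmean; apply: ge_sup; first by exists (dkernel_mod (0 + c)), 0.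
move=> _ [t _ <-]; rewrite (le_trans (dkernel_mod_le _))// -dkernel_mod0.
by apply: ub_le_sup; [exists (cmod a + cmod b) => _ [x _ <-]; exact: dkernel_mod_le|exists 0].
Qed.

Variables (p q : \bar R).
Hypotheses (hp : (1 <= p)%E) (hq : (1 <= q)%E) (hpq : (p^-1 + q^-1 = 1)%E).
Variables (k : {nonneg R}) (k0 : 0 < k%:num).
Local Notation mu := (mscale k (@arc_measure R)).
Local Notation C := (cmod (cab alpha beta) / (2 * pi * k%:num)).
Local Notation Q := (qmean k%:num q dkernel_mod).

Let C0 : 0 <= C.
Proof. by rewrite divr_ge0 ?cmod_ge0// !mulr_ge0 ?pi_ge0. Qed.

Let kphi w phi : Lp_ball mu p phi ->
  cintegrable mu (fun t => dkernel alpha beta w t * phi (eit t)).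
Proof.
move=> /(Lp_ball_cintegrable k0 hp hq hpq).
exact: (cintegrableMl (cmeasurable_dkernel _ _ _) (cmod_dkernel _ _ _)).
Qed.

Lemma Dreal_Lp_ball phi w : Lp_ball mu p phi ->
  cmod (Dreal (Poisson alpha beta phi) 0 w) =
  C * cmod (Cintegral mu setT (fun t => dkernel alpha beta w t * phi (eit t))).
Proof.
move=> Bphi; have gi := Lp_ball_cintegrable k0 hp hq hpq Bphi.
have [ar ai] := cintegrable_mscale_arc k0 gi.
rewrite Dreal_Poisson; last by split; exact: integrable_mscale.
rewrite (Cintegral_circle k0); last exact: kphi.
rewrite !cmodM cmod_real mulrA ger0_norm// invr_ge0.
by rewrite !mulr_ge0 ?pi_ge0.
Qed.

Lemma Dreal_le phi w : Lp_ball mu p phi -> cmod w = 1 ->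
  cmod (Dreal (Poisson alpha beta phi) 0 w) <= C * Q.
Proof.
move=> Bphi w1; rewrite Dreal_Lp_ball// ler_wpM2l//.
have [mr mi L1] := Bphi.
rewrite (le_trans (le_cmod_Cintegral (kphi w Bphi)))//.
apply: le_trans (qmean_dkernel k%:num hq w1).
set h := fun t => cmod (dkernel alpha beta w t).
have hM t : 0 <= h t <= cmod a + cmod b.
  by rewrite cmod_ge0 (le_trans (cmod_dkernel _ _ _ _))// w1 mulr1.
have mh : measurable_fun setT (h : T -> R).
  by apply: measurable_cmod; exact: cmeasurable_dkernel.
have := hoelder_ball k0 hp hq hpq mh hM (conj mr mi) L1.
under eq_integral do rewrite -cmodM.
rewrite -lee_fin /Rintegral fineK//; apply: integrable_fin_num => //.
by have [] := (cintegrableP _ _).1 (kphi w Bphi).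
Qed.

Lemma Dnorm_le phi : Lp_ball mu p phi -> Dnorm (Poisson alpha beta phi) 0 <= C * Q.
Proof.
move=> Bphi; apply: ge_sup.
  by exists (cmod (Dreal (Poisson alpha beta phi) 0 1)); exists 1 => //; exact: cmod1.
by move=> _ [w w1 <-]; exact: Dreal_le.
Qed.

(** A real [sup] bounds its set only if the set is bounded above, so even this lower estimate of
    [Dnorm] rests on [Dreal_le]. *)
Lemma Dreal_le_Dnorm phi w : Lp_ball mu p phi -> cmod w = 1 ->
  cmod (Dreal (Poisson alpha beta phi) 0 w) <= Dnorm (Poisson alpha beta phi) 0.
Proof.
move=> Bphi w1; apply: ub_le_sup; last by exists w.
by exists (C * Q) => _ [z z1 <-]; exact: Dreal_le.
Qed.

(** The loss [e] comes from p = 1; for p > 1 the extremal function reaches Q. *)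
Lemma Dnorm_ge (e : R) : 0 < e -> exists2 phi, Lp_ball mu p phi &
  C * (Q - e) <= Dnorm (Poisson alpha beta phi) 0.
Proof.
(* This angle cancels the translation in [cmod_dkernel_eit], so that |kappa| is [dkernel_mod], with
   its maximum at t = 0 as [extremal_oo] requires. *)
move=> e0; pose w : R[i] := eit ((cArg b - cArg a) / 2).
pose kappa z := ulin alpha beta (w * conjc z).
have hEt t : cmod (kappa (eit t)) = dkernel_mod t by rewrite [LHS]cmod_dkernel_eit subrr addr0.
have hE : (fun t : R => cmod (kappa (eit t))) = dkernel_mod by exact/funext.
have mK : cmeasurable (fun t : T => kappa (eit t)) by exact: cmeasurable_dkernel.
have hM t : cmod (kappa (eit t)) <= cmod a + cmod b.
  by rewrite hEt dkernel_mod_le.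
suff [phi Bphi H] : exists2 phi, Lp_ball mu p phi &
    Q - e <= cmod (Cintegral mu setT (fun t => kappa (eit t) * phi (eit t))).
  exists phi => //; apply: le_trans (Dreal_le_Dnorm Bphi (cmod_eit ((cArg b - cArg a) / 2))).
  by rewrite (Dreal_Lp_ball _ Bphi); apply: ler_wpM2l.
have Qe : Q - e <= Q by rewrite gerBl ltW.
case: (conjugate_cases hp hq hpq) => [[pE qE]|[pE qE]|[r [s [pE qE r1 s1 rs]]]].
- have [phi Bphi H] := extremal_1 k0 mK hM.
  by exists phi; rewrite ?pE//; apply: le_trans Qe _; rewrite qE -hE.
- have [||phi Bphi H] := extremal_oo k0 mK hM _ _ e0.
  + by rewrite hE; exact: continuous_dkernel_mod.
  + by move=> t; rewrite !hEt dkernel_mod0 dkernel_mod_le.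
  by exists phi; rewrite ?pE// qE -hE.
- have [phi Bphi H] := extremal_fin k mK hM r1 s1 rs.
  by exists phi; rewrite ?pE//; apply: le_trans Qe _; rewrite qE -hE.
Qed.

Lemma sup_Dnorm_Lp_ball :
  ereal_sup [set (Dnorm (Poisson alpha beta phi) 0)%:E | phi in Lp_ball mu p] = (C * Q)%:E.
Proof.
apply/eqP; rewrite eq_le; apply/andP; split.
  by apply: ge_ereal_sup => _ [phi Bphi <-]; rewrite lee_fin Dnorm_le.
apply/lee_subgt0Pr => e e0.
(* The loss e / (C + 1) is multiplied by C, and C e / (C + 1) <= e also when C = 0. *)
have C1 : 0 < C + 1 by rewrite ltr_wpDl.
have [phi Bphi H] := Dnorm_ge (divr_gt0 e0 C1).
apply: ereal_sup_ge; exists (Dnorm (Poisson alpha beta phi) 0)%:E; first by exists phi.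
rewrite -EFinB lee_fin; apply: le_trans H.
rewrite mulrBr lerB// mulrA ler_pdivrMr// mulrC.
by apply: ler_wpM2l; [exact: ltW|rewrite lerDl ler01].
Qed.

End main.

Theorem theorem3p2 (R : realType) (alpha beta : R[i]) (p q : \bar R)
    (halpha : forall n : nat, alpha <> - (n.+1)%:R)
    (hbeta : forall n : nat, beta <> - (n.+1)%:R)
    (hab : -1 < complex.Re alpha + complex.Re beta)
    (hp : (1 <= p)%E) (hq : (1 <= q)%E) (hpq : (p^-1 + q^-1 = 1)%E) :
  let F := fun t : R =>
    cmod ((cmod (alpha + 1))%:C + (cmod (beta + 1))%:C * eit (2 * t)) in
  let S := fun mu : {measure set (measurableTypeR R) -> \bar R} =>
    ereal_sup [set (Dnorm (Poisson alpha beta phi) 0)%:E | phi in Lp_ball mu p] in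
  (* unit ball of L^p for normalized arc length *)
  S circle_measure
    = (cmod (cab alpha beta) * qmean (2 * pi)^-1 q F)%:E /\
  (* unit ball of L^p for arc length *)
  S arc_measure
    = (cmod (cab alpha beta) / (2 * pi) * qmean 1 q F)%:E.
Proof.
move=> F S; have pi2 : 0 < 2 * pi :> R by rewrite mulr_gt0 ?pi_gt0.
split.
  have k0 : 0 < (NngNum (@inv2pi_ge0 R))%:num by rewrite /= invr_gt0.
  rewrite [LHS](sup_Dnorm_Lp_ball alpha beta hp hq hpq k0) /=.
  by rewrite mulfV ?gt_eqF// divr1.
have k0 : 0 < (NngNum (@ler01 R))%:num by exact: ltr01.
rewrite -mscale1_arc [LHS](sup_Dnorm_Lp_ball alpha beta hp hq hpq k0) /=.
by rewrite mulr1.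
Qed.
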